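(* Let $G$ be a countable infinite discrete abelian group acting by homeomorphisms on a compact Hausdorff space $X$, and suppose that there is some $x\in X$ whose stabilizer $G_x=\{s\in G:\sigma_s(x)=x\}$ is infinite. Then $\ell^1(G\curvearrowright X)$ has a closed and non-self-adjoint ideal.
   Context: Write $\sigma_s:X\to X$ for the homeomorphism given by $s\in G$, $e$ for the identity of $G$, and $C(X)$ for the continuous functions $X\to\mathbb{C}$ with the supremum norm $\|\cdot\|_\infty$. Set $\alpha_s(f)(x)=f(\sigma_s^{-1}(x))$ for $s\in G$, $f\in C(X)$, $x\in X$. $\ell^1(G\curvearrowright X)$ is the Banach $*$-algebra of all functions $f:G\to C(X)$ with $\|f\|=\sum_{s\in G}\|f(s)\|_\infty<\infty$, with pointwise linear operations, product $(fg)(s)=\sum_{t\in G}f(t)\,\alpha_t(g(t^{-1}s))$ and involution $(f^* )(s)=\alpha_s(\overline{f(s^{-1})})$. ''Ideal'' means two-sided ideal. An ideal $I$ is self-adjoint if $f^*\in I$ for every $f\in I$. *)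

(* Defs.v *)
From HB Require Import structures.
From mathcomp Require Import all_boot all_order all_algebra finmap complex lra.
From mathcomp Require Import all_classical all_reals all_analysis.
From mathcomp.analysis Require Import showcase.summability.
Import Order.TTheory GRing.Theory Num.Theory.
Import numFieldNormedType.Exports.

Set Implicit Arguments.
Unset Strict Implicit.
Unset Printing Implicit Defensive.

Import Normc.
Local Notation Re := (@complex.Re _).
Local Notation Im := (@complex.Im _).

Local Open Scope classical_set_scope.
Local Open Scope complex_scope.
Local Open Scope ring_scope.

(* The usual topology of the complex numbers.                                 *)
HB.instance Definition _ (R : realType) := NormedModule.copy R[i] R[i]^o.

Section ComplexComplete.
Variable R : realType.
Implicit Types z : R[i].

Definition cabs (z : R[i]) : R := normc z.

Lemma normr_cabs z : `|z| = (cabs z)%:C.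
Proof. by rewrite normc_def; case: z => a b. Qed.

Lemma cabsD z1 z2 : cabs (z1 + z2) <= cabs z1 + cabs z2.
Proof. exact: le_normcD. Qed.

Lemma cabsM z1 z2 : cabs (z1 * z2) = cabs z1 * cabs z2.
Proof. exact: normcM. Qed.

Lemma cabsN z : cabs (- z) = cabs z.
Proof. exact: normcN. Qed.

Lemma cabs0 : cabs 0 = 0 :> R.
Proof. exact: normc0. Qed.

Lemma cabs_eq0 z : cabs z = 0 -> z = 0.
Proof. exact: eq0_normc. Qed.

Lemma cabs_ge0 z : 0 <= cabs z.
Proof. by rewrite -lecR -normr_cabs normr_ge0. Qed.

Lemma cabs_conj z : cabs z^*%C = cabs z.
Proof. by apply: (@complexI R); rewrite -!normr_cabs normcJ. Qed.

Lemma normr_Re_le z : `|Re z| <= cabs z.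
Proof. by rewrite -lecR -normr_cabs normc_ge_Re. Qed.

Lemma normr_Im_le z : `|Im z| <= cabs z.
Proof. by case: z => a b /=; rewrite -sqrtr_sqr ler_wsqrtr// lerDr sqr_ge0. Qed.

Lemma cabs_le_ReIm z : cabs z <= `|Re z| + `|Im z|.
Proof.
have -> : z = (Re z)%:C + (0 +i* Im z).
  by apply/eqP; rewrite eq_complex /= addr0 add0r !eqxx.
apply: (le_trans (cabsD _ _)) => /=.
by rewrite expr0n /= !(addr0, add0r) !sqrtr_sqr.
Qed.

Lemma continuous_cabs : continuous cabs.
Proof.
move=> z; apply/(@cvgrPdist_lt _ _ _ (nbhs z)) => e e0.
have e0' : (0 : R[i]) < e%:C by rewrite ltcR.
apply: filterS (nbhsx_ballx z _ e0') => w; rewrite /ball /= /ball_.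
rewrite normr_cabs ltcR; apply: le_lt_trans.
rewrite ler_norml; apply/andP; split.
  rewrite lerNl opprB lerBlDr -{1}(subrK z w) (le_trans (cabsD _ _))//.
  by rewrite lerD2r -opprB cabsN.
by rewrite lerBlDr -{1}(subrK w z) (le_trans (cabsD _ _)).
Qed.

Lemma complex_complete (F : set_system R[i]) :
  ProperFilter F -> cauchy F -> cvg F.
Proof.
move=> FF /cauchy_ballP Fc.
have part (p : R[i] -> R) : (forall z w, `|p z - p w| <= cabs (z - w)) ->
    cvg (p @ F).
  move=> pP; apply/cauchy_cvgP/cauchy_ballP => e e0.
  have e0' : (0 : R[i]) < e%:C by rewrite ltcR.
  have := Fc _ e0'; rewrite !near_simpl /=.
  move=> [[A B] [/= FA FB] AB].
  exists (p @` A, p @` B) => /=.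
    by split; [apply: filterS FA|apply: filterS FB] => z Az; exists z.
  move=> [_ _] /= [[z Az <-] [w Bw <-]].
  have /= := AB (z, w) (conj Az Bw); rewrite /ball /= /ball_ normr_cabs ltcR.
  exact: le_lt_trans.
have /part Rc z w : `|Re z - Re w| <= cabs (z - w).
  by have := normr_Re_le (z - w); rewrite raddfB.
have /part Ic z w : `|Im z - Im w| <= cabs (z - w).
  by have := normr_Im_le (z - w); rewrite raddfB.
apply/cvg_ex; exists (lim (Re @ F) +i* lim (Im @ F)).
apply/cvgrPdist_lt => e e0.
have e0' : 0 < Re e by move: e0; rewrite ltcE /= => /andP[].
have eE : e = (Re e)%:C by rewrite RRe_real// gtr0_real.
have e2 : 0 < Re e / 2 by rewrite divr_gt0.
near=> z.
rewrite eE normr_cabs ltcR (le_lt_trans (cabs_le_ReIm _))// [ltRHS]splitr.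
rewrite !raddfB /= ltrD//; near: z.
- by move/cvgrPdist_lt : Rc => /(_ _ e2).
- by move/cvgrPdist_lt : Ic => /(_ _ e2).
Unshelve. all: by end_near. Qed.

HB.instance Definition _ := Uniform_isComplete.Build R[i] complex_complete.

End ComplexComplete.

Section ContinuousFunctions.
Variables (R : realType) (X : topologicalType).

Definition continuous_pred : {pred X -> R[i]} := fun f => `[< continuous f >].

Lemma continuous_predP f : reflect (continuous f) (f \in continuous_pred).
Proof. exact: asboolP. Qed.

Fact continuous_pred_submod : submod_closed continuous_pred.
Proof.
split; first by apply/continuous_predP => x; exact: cvg_cst.
move=> a f g /continuous_predP cf /continuous_predP cg; apply/continuous_predP.
move=> x; apply: (@cvgD _ _ _ (nbhs x) _ (a \*: f) g); last exact: cg.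
by apply: (@cvgZr _ _ _ (nbhs x)); exact: cf.
Qed.

HB.instance Definition _ :=
  GRing.isSubmodClosed.Build R[i] (X -> R[i]) continuous_pred
    continuous_pred_submod.

(* [C(X)]. Compactness of [X] makes the supremum norm below finite.           *)
Record contfun (cX : compact [set: X]) :=
  ContFun { contfun_val :> X -> R[i]; _ : contfun_val \in continuous_pred }.

Variable cX : compact [set: X].

HB.instance Definition _ := [isSub for @contfun_val cX].
HB.instance Definition _ := [Choice of contfun cX by <:].
HB.instance Definition _ := [SubChoice_isSubLmodule of contfun cX by <:].

Implicit Types f g : contfun cX.

(* If [X] is empty this is [sup set0 = 0].                                    *)
Definition supnorm f : R := sup [set cabs (f x) | x in [set: X]].

Lemma contfunP f : continuous f.
Proof. exact/continuous_predP/(valP f). Qed.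

Lemma contfun_ext f g : f =1 g -> f = g.
Proof. by move=> fg; apply/val_inj/funext. Qed.

Lemma contfun0E x : (0 : contfun cX) x = 0.
Proof. by []. Qed.

Lemma contfunDE f g x : (f + g) x = f x + g x.
Proof. by []. Qed.

Lemma contfunBE f g x : (f - g) x = f x - g x.
Proof. by []. Qed.

Lemma contfunZE a f x : (a *: f) x = a * f x.
Proof. by []. Qed.

Lemma has_ubound_cabs f : has_ubound [set cabs (f x) | x in [set: X]].
Proof.
have : compact ((@cabs R \o f) @` [set: X]).
  apply: continuous_compact => //; apply: continuous_subspaceT => x.
  apply: continuous_comp; [exact: contfunP|exact: continuous_cabs].
move=> /compact_bounded [M [Mr MP]]; exists (M + 1) => _ [x _ <-].
apply: le_trans (MP _ _ _ _); first exact: ler_norm.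
- by rewrite ltrDl.
- by exists x.
Qed.

Lemma cabs_le_supnorm f x : cabs (f x) <= supnorm f.
Proof. by apply: ub_le_sup; [exact: has_ubound_cabs|exists x]. Qed.

Lemma supnorm_le f M :
  0 <= M -> (forall x, cabs (f x) <= M) -> supnorm f <= M.
Proof.
move=> M0 fM; have [x|nX] := pselect (exists x : X, True).
  by case: x => x _; apply: ge_sup; [exists (cabs (f x)), x|move=> _ [y _ <-]].
rewrite /supnorm (_ : [set _ | _ in _] = set0) ?sup0//.
by apply/seteqP; split => // y [x _ _]; case: nX; exists x.
Qed.

Lemma supnorm_ge0 f : 0 <= supnorm f.
Proof.
have [[x _]|nX] := pselect (exists x : X, True).
  exact: le_trans (cabs_ge0 _) (cabs_le_supnorm f x).
rewrite /supnorm (_ : [set _ | _ in _] = set0) ?sup0//.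
by apply/seteqP; split => // y [x _ _]; case: nX; exists x.
Qed.

Lemma supnormD f g : supnorm (f + g) <= supnorm f + supnorm g.
Proof.
apply: supnorm_le => [|x]; first by rewrite addr_ge0 ?supnorm_ge0.
by rewrite (le_trans (cabsD _ _))// lerD// cabs_le_supnorm.
Qed.

Lemma supnormZ a f : supnorm (a *: f) = cabs a * supnorm f.
Proof.
have H b g : supnorm (b *: g) <= cabs b * supnorm g.
  apply: supnorm_le => [|x]; first by rewrite mulr_ge0 ?cabs_ge0 ?supnorm_ge0.
  by rewrite contfunZE cabsM ler_wpM2l ?cabs_ge0 ?cabs_le_supnorm.
apply/eqP; rewrite eq_le H andTb.
have [->|a0] := eqVneq a 0; first by rewrite cabs0 mul0r supnorm_ge0.
have ca : 0 < cabs a by rewrite -ltcR -normr_cabs normr_gt0.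
rewrite -ler_pdivlMl//; have := H a^-1 (a *: f).
rewrite scalerA mulVf// scale1r => /le_trans; apply.
by rewrite -[cabs a^-1](mulfK (lt0r_neq0 ca)) -cabsM mulVf// /cabs normc1 mul1r.
Qed.

Lemma supnorm_eq0 f : supnorm f = 0 -> f = 0.
Proof.
move=> f0; apply: contfun_ext => x; apply: cabs_eq0; apply/eqP.
by rewrite eq_le cabs_ge0 -f0 cabs_le_supnorm.
Qed.

Fact contfun_normD f g :
  (supnorm (f + g))%:C <= (supnorm f)%:C + (supnorm g)%:C :> R[i].
Proof. by rewrite -rmorphD lecR supnormD. Qed.

Fact contfun_normZ (a : R[i]) f : (supnorm (a *: f))%:C = `|a| * (supnorm f)%:C.
Proof. by rewrite normr_cabs -rmorphM supnormZ. Qed.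

Fact contfun_norm_eq0 f : (supnorm f)%:C = 0 :> R[i] -> f = 0.
Proof. by move=> [/supnorm_eq0]. Qed.

HB.instance Definition _ := Lmodule_isNormed.Build R[i] (contfun cX)
  contfun_normD contfun_normZ contfun_norm_eq0.

Lemma contfun_normE f : `|f| = (supnorm f)%:C.
Proof. by []. Qed.

End ContinuousFunctions.

Section ContinuousComplete.
Variables (R : realType) (X : topologicalType) (cX : compact [set: X]).
Local Notation C_X := (contfun R cX).

Lemma contfun_complete (F : set_system C_X) :
  ProperFilter F -> cauchy F -> cvg F.
Proof.
move=> FF /cauchy_ballP Fc.
have evB (f g : C_X) x : `|f x - g x| <= `|f - g|.
  by rewrite normr_cabs contfun_normE lecR; exact: (cabs_le_supnorm (f - g)).
have evc x : cvg ((fun f : C_X => f x) @ F).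
  apply: complex_complete; apply/cauchy_ballP => e e0.
  have [[A B] [/= FA FB] AB] := Fc _ e0.
  exists ((fun f : C_X => f x) @` A, (fun f : C_X => f x) @` B) => /=.
    by split; [apply: filterS FA|apply: filterS FB] => f Af; exists f.
  move=> [_ _] /= [[f Af <-] [g Bg <-]].
  have /= := AB (f, g) (conj Af Bg); rewrite -ball_normE /ball /= /ball_.
  exact: le_lt_trans.
pose l x : R[i] := lim ((fun f : C_X => f x) @ F).
have lP (e : R) : 0 < e ->
    F [set f : C_X | forall x, cabs (l x - f x) <= e].
  move=> e0.
  have e0' : (0 : R[i]) < (e / 2)%:C by rewrite ltcR divr_gt0.
  have [[A B] [/= FA FB] AB] := Fc _ e0'.
  apply: filterS FB => g Bg x.
  have /(@cvgrPdist_lt _ _ _ F) /(_ _ e0') Fx := evc x.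
  have [f [Af fl]] := @filter_ex _ F _ _ (filterI FA Fx).
  have := AB (f, g) (conj Af Bg); rewrite /= -ball_normE /ball_ /= => fg.
  rewrite -lecR -normr_cabs (_ : _ - _ = (l x - f x) + (f x - g x)); last first.
    by rewrite addrA subrK.
  rewrite (le_trans (ler_normD _ _))// [e]splitr rmorphD lerD ?ltW//.
  exact: le_lt_trans fg.
have lc : continuous l.
  move=> x; apply/(@cvgrPdist_lt _ _ _ (nbhs x)) => e e0.
  have e0' : 0 < Re e by move: e0; rewrite ltcE /= => /andP[].
  have eE : e = (Re e)%:C by rewrite RRe_real// gtr0_real.
  have e3 : 0 < Re e / 4 by rewrite divr_gt0.
  have [f fl] := @filter_ex _ F _ _ (lP _ e3).
  have e3' : (0 : R[i]) < (Re e / 4)%:C by rewrite ltcR.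
  have /(@cvgrPdist_lt _ _ _ (nbhs x)) /(_ _ e3') := @contfunP _ _ _ f x.
  apply: filterS => y; rewrite eE !normr_cabs !ltcR => fxy.
  rewrite (_ : _ - _ = (l x - f x) + ((f x - f y) + (f y - l y))); last first.
    by rewrite !addrA !subrK.
  apply: (le_lt_trans (cabsD _ _)); apply: (le_lt_trans (lerD (fl x) (cabsD _ _))).
  have := fl y; rewrite -cabsN opprB => fly.
  apply: (@le_lt_trans _ _ (Re e / 4 + (Re e / 4 + Re e / 4))).
    by rewrite !lerD// ltW.
  by lra.
have lC : l \in @continuous_pred R X by exact/continuous_predP.
apply/cvg_ex; exists (ContFun cX lC); apply/(@cvgrPdist_le _ _ _ F) => e e0.
have e0' : 0 < Re e by move: e0; rewrite ltcE /= => /andP[].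
have eE : e = (Re e)%:C by rewrite RRe_real// gtr0_real.
apply: filterS (lP _ e0') => f fl.
by rewrite eE contfun_normE lecR supnorm_le// ltW.
Qed.

HB.instance Definition _ := Uniform_isComplete.Build C_X contfun_complete.

End ContinuousComplete.

#[local] Existing Instance totally_filter.

Section AbsoluteSum.
Variables (R : realType) (I : choiceType) (V : completeNormedModType R[i]).
Variables (f : I -> V) (n : I -> R).
Hypothesis fn : forall i, `|f i| = (n i)%:C.
Hypothesis n_fin : (\esum_(i in [set: I]) (n i)%:E < +oo)%E.

Let n_ge0 i : 0 <= n i.
Proof. by rewrite -lecR -fn normr_ge0. Qed.

Let S := fine (\esum_(i in [set: I]) (n i)%:E).

Let SE : (\esum_(i in [set: I]) (n i)%:E)%E = S%:E.
Proof.
by rewrite fineK// ge0_fin_numE// esum_ge0// => i _; rewrite lee_fin.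
Qed.

Let partial_sumE (W : zmodType) (h : I -> W) (A : {fset I}) :
  partial_sum h A = \sum_(i <- A) h i.
Proof. by rewrite /partial_sum big_seq_fsetE. Qed.

Let sum_le_S (A : {fset I}) : \sum_(i <- A) n i <= S.
Proof.
rewrite -lee_fin -SE -sumEFin; apply: ereal_sup_ubound.
exists [set` A]; first by split; [exact: finite_fset|].
by rewrite fsbig_finite ?finite_fset//= set_fsetK.
Qed.

Let sum_norm (A : {fset I}) : `|\sum_(i <- A) f i| <= (\sum_(i <- A) n i)%:C.
Proof.
rewrite (le_trans (ler_norm_sum _ _ _))// rmorph_sum /= le_eqVlt.
by under eq_bigr do rewrite fn; rewrite eqxx.
Qed.

Lemma is_cvg_sum : cvg (partial_sum f @ totally).
Proof.
apply/cauchy_cvgP/cauchy_ballP => e e0.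
have e0' : 0 < Re e by move: e0; rewrite ltcE /= => /andP[].
have eE : e = (Re e)%:C by rewrite RRe_real// gtr0_real.
have e2 : 0 < Re e / 2 by rewrite divr_gt0.
have : ((S - Re e / 2)%:E < \esum_(i in [set: I]) (n i)%:E)%E.
  by rewrite SE lte_fin ltrBlDr ltrDl.
move=> /ereal_sup_gt[_ [F0 [finF0 _] <-]].
rewrite fsbig_finite//= sumEFin lte_fin; set A := fset_set F0 => HA.
have near_A (B : {fset I}) : (A `<=` B)%fset ->
    `|partial_sum f B - \sum_(i <- A) f i| < (Re e / 2)%:C.
  move=> AB; rewrite partial_sumE (big_fsetID _ (mem A)) /=.
  have -> : [fset x | x in B & x \in A]%fset = A.
    by apply/fsetP => i; rewrite !inE /= andb_idl// => /(fsubsetP AB).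
  rewrite [X in X - _]addrC addrK (le_lt_trans (sum_norm _))// ltcR.
  rewrite -(ltrD2l (\sum_(i <- A) n i)); apply: (@le_lt_trans _ _ S).
    apply: le_trans (sum_le_S B); rewrite [leRHS](big_fsetID _ (mem A)) /=.
    have -> : [fset x | x in B & x \in A]%fset = A.
      by apply/fsetP => i; rewrite !inE /= andb_idl// => /(fsubsetP AB).
    by [].
  by move: HA; rewrite ltrBlDr.
pose P := [set x : V | `|x - \sum_(i <- A) f i| < (Re e / 2)%:C].
have FP : (partial_sum f @ totally) P by exists A => // B; exact: near_A.
exists (P, P) => //= -[x y] [/= Px Py].
rewrite -ball_normE /ball_ /= -(subrKA (\sum_(i <- A) f i)).
rewrite (le_lt_trans (ler_normD _ _))// eE [X in X%:C]splitr rmorphD ltrD//.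
by rewrite distrC.
Qed.

Lemma sum_norm_le : `|summability.sum f| <= S%:C.
Proof.
apply/ler_addgt0Pr => e e0.
have := is_cvg_sum => /(@cvgrPdist_lt _ _ _ totally) /(_ _ e0) H.
have [A] := filter_ex H; rewrite partial_sumE -/(summability.sum f) => HA.
rewrite -(subrK (\sum_(i <- A) f i) (summability.sum f)) [leRHS]addrC.
rewrite (le_trans (ler_normD _ _))// lerD ?(ltW HA)//.
by rewrite (le_trans (sum_norm A))// lecR.
Qed.

End AbsoluteSum.

Section EsumLemmas.
Variable R : realType.
Local Open Scope ereal_scope.

Lemma esumZl_le (I : choiceType) (c : R) (a : I -> \bar R) :
  (0 <= c)%R -> (forall i, 0 <= a i) ->
  \esum_(i in [set: I]) (c%:E * a i) <= c%:E * \esum_(i in [set: I]) a i.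
Proof.
move=> c0 a0; apply: ge_ereal_sup => _ [A [finA _] <-].
rewrite fsbig_finite//= -ge0_sume_distrr//.
rewrite lee_wpmul2l// ?lee_fin//; apply: ereal_sup_ubound.
by exists A => //; rewrite fsbig_finite.
Qed.

Lemma esum_swap (I J : choiceType) (a : I -> J -> \bar R) :
  (forall i j, 0 <= a i j) ->
  \esum_(i in [set: I]) \esum_(j in [set: J]) a i j =
  \esum_(j in [set: J]) \esum_(i in [set: I]) a i j.
Proof.
move=> a0; rewrite esum_esum// esum_esum//.
rewrite (@reindex_esum R (J * I)%type (I * J)%type
  ([set: J] `*`` fun=> [set: I]) _ (fun z => (z.2, z.1)))//.
split => //; first by move=> [x1 x2] [y1 y2] _ _ /= [-> ->].
by move=> [x y] _; exists (y, x).
Qed.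

Lemma esum_shift (G : zmodType) (t : G) (a : G -> \bar R) :
  \esum_(s in [set: G]) a (s - t)%R = \esum_(s in [set: G]) a s.
Proof.
apply/esym/(@reindex_esum R G G setT setT (fun s => s - t)%R); split => //.
  by move=> x y _ _ /subIr.
by move=> x _; exists (x + t)%R => //; rewrite addrK.
Qed.

Lemma esum_reflect (G : zmodType) (a : G -> \bar R) :
  \esum_(s in [set: G]) a (- s)%R = \esum_(s in [set: G]) a s.
Proof.
apply/esym/(@reindex_esum R G G setT setT -%R); split => //.
Qed.

Lemma esum_ge_term (I : choiceType) (a : I -> \bar R) i :
  a i <= \esum_(j in [set: I]) a j.
Proof.
apply: ereal_sup_ubound; exists [set i]; first by split; [exact: finite_set1|].
by rewrite fsbig_set1.
Qed.

End EsumLemmas.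

(* The group law of [G] is written additively; each [sigma s] is a            *)
(* homeomorphism, with continuous inverse [sigma (- s)].                      *)
Record top_action (G : zmodType) (X : topologicalType) := TopAction {
  act :> G -> X -> X;
  act_continuous : forall s, continuous (act s);
  act0 : forall x, act 0 x = x;
  actD : forall s t x, act (s + t) x = act s (act t x)
}.

Definition stabilizer (G : zmodType) (X : topologicalType) (sigma : top_action G X)
  (x : X) : set G := [set s | sigma s x = x].

Section ContfunOperations.
Variables (R : realType) (X : topologicalType) (cX : compact [set: X]).
Implicit Types f g : contfun R cX.

Fact contfun_mul_subproof f g : (fun x => f x * g x) \in @continuous_pred R X.
Proof.
apply/continuous_predP => x.
by apply: (@cvgM _ _ (nbhs x)); exact: contfunP.
Qed.

Definition contfun_mul f g := ContFun cX (contfun_mul_subproof f g).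

Fact contfun_conj_subproof f : (fun x => (f x)^*%C) \in @continuous_pred R X.
Proof.
apply/continuous_predP => x; apply/(@cvgrPdist_lt _ _ _ (nbhs x)) => e e0.
have /(@cvgrPdist_lt _ _ _ (nbhs x)) /(_ _ e0) := @contfunP _ _ _ f x.
by apply: filterS => y; rewrite -raddfB /= normcJ.
Qed.

Definition contfun_conj f := ContFun cX (contfun_conj_subproof f).

Lemma supnorm_mul f g : supnorm (contfun_mul f g) <= supnorm f * supnorm g.
Proof.
apply: supnorm_le => [|x]; first by rewrite mulr_ge0 ?supnorm_ge0.
by rewrite [cabs _]cabsM ler_pM ?cabs_ge0 ?cabs_le_supnorm.
Qed.

Lemma supnorm_conj f : supnorm (contfun_conj f) <= supnorm f.
Proof.
apply: supnorm_le => [|x]; first exact: supnorm_ge0.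
by rewrite [cabs _]cabs_conj cabs_le_supnorm.
Qed.

Variables (G : zmodType) (sigma : top_action G X).

Fact alpha_subproof s f : (fun x => f (sigma (- s) x)) \in @continuous_pred R X.
Proof.
apply/continuous_predP => x; apply: continuous_comp; last exact: contfunP.
exact: act_continuous.
Qed.

Definition alpha s f := ContFun cX (alpha_subproof s f).

Lemma supnorm_alpha s f : supnorm (alpha s f) <= supnorm f.
Proof.
apply: supnorm_le => [|x]; first exact: supnorm_ge0.
exact: (cabs_le_supnorm f).
Qed.

End ContfunOperations.

Section L1.
Variables (R : realType) (G : zmodType) (X : topologicalType).
Variable cX : compact [set: X].
Local Notation CX := (contfun R cX).

Definition l1norm (f : G -> CX) : \bar R :=
  \esum_(s in [set: G]) (supnorm (f s))%:E.

Lemma l1norm_ge0 f : (0 <= l1norm f)%E.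
Proof. by apply: esum_ge0 => s _; rewrite lee_fin supnorm_ge0. Qed.

Lemma l1normD f g : (l1norm (f + g)%R <= l1norm f + l1norm g)%E.
Proof.
rewrite /l1norm -esumD; try by move=> s _; rewrite lee_fin supnorm_ge0.
by apply: le_esum => s _; rewrite -EFinD lee_fin supnormD.
Qed.

Lemma l1normZ_le a f : (l1norm (a *: f)%R <= (cabs a)%:E * l1norm f)%E.
Proof.
apply: le_trans (esumZl_le _ _); rewrite ?cabs_ge0//.
  by apply: le_esum => s _; rewrite -EFinM supnormZ.
by move=> s; rewrite lee_fin supnorm_ge0.
Qed.

Definition l1_pred : {pred G -> CX} := fun f => (l1norm f < +oo)%E.

Fact l1_pred_submod : submod_closed l1_pred.
Proof.
split.
  rewrite unfold_in /l1norm esum1// => s _.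
  by congr (_%:E); apply/eqP; rewrite eq_le supnorm_ge0 andbT supnorm_le// => x;
    rewrite [cabs _]cabs0.
move=> a f g; rewrite !unfold_in => f1 g1.
rewrite (le_lt_trans (l1normD _ _))// lte_add_pinfty//.
rewrite (le_lt_trans (l1normZ_le _ _))// lte_mul_pinfty// lee_fin.
exact: cabs_ge0.
Qed.

HB.instance Definition _ :=
  GRing.isSubmodClosed.Build R[i] (G -> CX) l1_pred l1_pred_submod.

Record l1 := L1 { l1_val :> G -> CX; _ : l1_val \in l1_pred }.

HB.instance Definition _ := [isSub for l1_val].
HB.instance Definition _ := [Choice of l1 by <:].
HB.instance Definition _ := [SubChoice_isSubLmodule of l1 by <:].

Implicit Types f g : l1.

Lemma l1P f : (l1norm f < +oo)%E.
Proof. exact: valP f. Qed.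

Lemma l1norm_fin f : l1norm f \is a fin_num.
Proof. by rewrite ge0_fin_numE ?l1norm_ge0 ?l1P. Qed.

Definition l1_norm f : R[i] := (fine (l1norm f))%:C.

Fact l1_normD f g : l1_norm (f + g) <= l1_norm f + l1_norm g.
Proof.
rewrite -rmorphD lecR -lee_fin EFinD !fineK ?l1norm_fin//.
exact: l1normD.
Qed.

Fact l1_normZ a f : l1_norm (a *: f) = `|a| * l1_norm f.
Proof.
have H b g : fine (l1norm (b *: g : l1)) <= cabs b * fine (l1norm g).
  by rewrite -lee_fin EFinM !fineK ?l1norm_fin//; exact: l1normZ_le.
rewrite /l1_norm normr_cabs -rmorphM; congr (_%:C).
apply/eqP; rewrite eq_le H andTb.
have [->|a0] := eqVneq a 0; first by rewrite cabs0 mul0r fine_ge0// l1norm_ge0.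
have ca : 0 < cabs a by rewrite -ltcR -normr_cabs normr_gt0.
rewrite -ler_pdivlMl//; have := H a^-1 (a *: f).
rewrite scalerA mulVf// scale1r => /le_trans; apply.
by rewrite -[cabs a^-1](mulfK (lt0r_neq0 ca)) -cabsM mulVf// /cabs normc1 mul1r.
Qed.

Fact l1_norm_eq0 f : l1_norm f = 0 -> f = 0.
Proof.
move=> [f0]; apply/val_inj/funext => s /=; apply: supnorm_eq0.
apply/eqP; rewrite eq_le supnorm_ge0 andbT -lee_fin -f0 fineK ?l1norm_fin//.
exact: (@esum_ge_term R G (fun s => (supnorm (f s))%:E)).
Qed.

HB.instance Definition _ := Lmodule_isNormed.Build R[i] l1
  l1_normD l1_normZ l1_norm_eq0.

Lemma l1_normE f : `|f| = (fine (l1norm f))%:C.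
Proof. by []. Qed.

Variable sigma : top_action G X.

Fact l1_mul_subproof f g :
  (fun s => summability.sum (fun t =>
    contfun_mul (f t) (alpha sigma t (g (s - t))))) \in l1_pred.
Proof.
pose a s t : \bar R := ((supnorm (f t))%:E * (supnorm (g (s - t)))%:E)%E.
have a0 s t : (0 <= a s t)%E by rewrite mule_ge0// lee_fin supnorm_ge0.
pose h s t := contfun_mul (f t) (alpha sigma t (g (s - t))).
have ha s : (\esum_(t in [set: G]) (supnorm (h s t))%:E <=
    \esum_(t in [set: G]) a s t)%E.
  apply: le_esum => t _; rewrite /a -EFinM lee_fin (le_trans (supnorm_mul _ _))//.
  by rewrite ler_wpM2l ?supnorm_ge0// supnorm_alpha.
have asum : (\esum_(s in [set: G]) \esum_(t in [set: G]) a s t < +oo)%E.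
  rewrite esum_swap//.
  apply: (@le_lt_trans _ _ (\esum_(t in [set: G])
      ((fine (l1norm g))%:E * (supnorm (f t))%:E))%E).
    apply: le_esum => t _; apply: le_trans (esumZl_le _ _) _.
    - exact: supnorm_ge0.
    - by move=> s; rewrite lee_fin supnorm_ge0.
    - by rewrite (esum_shift t (fun u => (supnorm (g u))%:E)) fineK ?l1norm_fin// muleC.
  apply: (le_lt_trans (esumZl_le _ _)).
  - by rewrite fine_ge0// l1norm_ge0.
  - by move=> s; rewrite lee_fin supnorm_ge0.
  - by rewrite lte_mul_pinfty ?l1P// lee_fin fine_ge0// l1norm_ge0.
rewrite unfold_in (le_lt_trans _ asum)//; apply: le_esum => s _.
have hfin : (\esum_(t in [set: G]) (supnorm (h s t))%:E < +oo)%E.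
  apply: (le_lt_trans (ha s)); apply: le_lt_trans asum.
  exact: (@esum_ge_term R G (fun s => \esum_(t in [set: G]) a s t)%E).
apply: le_trans (ha s).
have := @sum_norm_le R G _ (h s) _ (fun t => contfun_normE _) hfin.
rewrite contfun_normE lecR -lee_fin fineK// ge0_fin_numE//.
by apply: esum_ge0 => t _; rewrite lee_fin supnorm_ge0.
Qed.

(* [t^-1 s] reads [s - t]. The sum over [G] is the limit in [C(X)] of the net *)
(* of its finite partial sums; it exists by [is_cvg_sum], the series being    *)
(* absolutely convergent.                                                     *)
Definition l1_mul f g : l1 := L1 (l1_mul_subproof f g).

Fact l1_star_subproof f :
  (fun s => alpha sigma s (contfun_conj (f (- s)))) \in l1_pred.
Proof.
rewrite unfold_in (le_lt_trans _ (l1P f))//.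
rewrite -[leRHS]esum_reflect; apply: le_esum => s _; rewrite lee_fin.
exact: le_trans (supnorm_alpha _ _ _) (supnorm_conj _).
Qed.

Definition l1_star f : l1 := L1 (l1_star_subproof f).

Record is_ideal (I : set l1) : Prop := IsIdeal {
  ideal0 : I 0;
  idealD : forall f g, I f -> I g -> I (f + g);
  idealZ : forall (a : R[i]) f, I f -> I (a *: f);
  idealMl : forall f g, I g -> I (l1_mul f g);
  idealMr : forall f g, I f -> I (l1_mul f g)
}.

Definition self_adjoint (I : set l1) : Prop := forall f, I f -> I (l1_star f).

End L1.

(* Main.v *)
(* Let H be the stabilizer of x. For every bounded psi on G supported in H,   *)
(* the f with sum_h f(t + h)(sigma_s x) psi(h) = 0 for all s and t form a     *)
(* closed ideal. Writing psi(h) = T(- h), a function a in l1(H), viewed as    *)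
(* constant in X, belongs to it iff a * T = 0. So one needs a and T with      *)
(* a * T = 0 but a^* * T <> 0: a failure of spectral synthesis in l1(H)       *)
(* (Malliavin).                                                               *)
(*   Take commuting unitaries F_w = exp(i (u f1 + v f2)), w = (u, v) in Z^2,  *)
(* with f1, f2 self-adjoint in l1(H), and T = sum_w (i u + v) F_w, a          *)
(* derivative of "delta(f1, f2)". Then a = (F_(1,0) - 1) - i (F_(0,1) - 1)    *)
(* kills T, while a^* * T = 2i sum_w F_w.                                     *)
(*   It remains to make the sup norm of F_w decay fast in w. Take             *)
(* f1 = sum_k a_k c_k with c_k = (delta_{h_k} + delta_{-h_k}) / 2, and        *)
(* similarly f2. If h is far from the essential support of a finite part P of *)
(* the exponential, then P, P shifted by h and P shifted by -h hardly overlap,*)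
(* so that multiplication by exp(i lambda c) shrinks the sup norm of P by a   *)
(* factor 1 - lambda^2 / 20. The h_k are chosen one after the other so that   *)
(* this applies to all relevant w; unitarity gives the bound 1 before that.   *)

From HB Require Import structures.
Require Import Defs.
From mathcomp Require Import all_boot all_order all_algebra finmap complex.
From mathcomp Require Import ring lra zify.
From mathcomp Require Import all_classical all_reals all_analysis.
From mathcomp.analysis Require Import showcase.summability.
Import Order.TTheory GRing.Theory Num.Theory.
Import numFieldNormedType.Exports.

Set Implicit Arguments.
Unset Strict Implicit.
Unset Printing Implicit Defensive.

Local Open Scope classical_set_scope.
Local Open Scope complex_scope.
Local Open Scope ring_scope.

#[local] Existing Instance totally_filter.

(** * Absolutely convergent sums *)

(** A bounded function [psi] carried by the stabilizer H of x yields bounded functionals f ->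
    [pairing f s t]. The pairings of a product are absolutely convergent combinations of pairings of
    either factor ([pairing_mull], [pairing_mulr]), so their common kernel [induced] is a closed
    two-sided ideal ([induced_ideal], [induced_closed]). On elements constant along X it only sees
    convolution with T, where psi(h) = T(- h). The theorem thus reduces to [exists_obstruction]: an
    a in l1(H) and a bounded T on H with a * T = 0 while the adjoint of a does not kill T.

    Such a pair comes from calculus in two self-adjoint elements f1, f2. With z = f1 + i f2, the
    series T is up to a constant the z-derivative of a Dirac mass at 0. To first order a is a
    multiple of the conjugate of z, which that derivative does not see, whereas the adjoint of a is
    a multiple of z and gives back the Dirac mass.

    This makes sense once the Fourier series of T converges in sup norm, that is, once the
    coefficients of F_w = exp(i (u f1 + v f2)) decay fast in w = (u, v); [exists_unitary_family]
    provides any polynomial rate. Each factor exp(i lambda c_k) with a well separated frequency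
    shrinks the sup norm ([expl_cosl_contraction]). The frequencies are found one by one in the
    infinite group H ([exists_frequencies]), and about K sqrt(N) factors act on a w of size N
    ([decay_eventually]), which beats every power of N. *)

Section NonnegativeSums.
Variable R : realType.
Implicit Types I J : choiceType.
Local Open Scope ereal_scope.

Lemma esum_finsupp I (a : I -> \bar R) (A : {fset I}) :
  (forall i, 0 <= a i) -> (forall i, i \notin A -> a i = 0) ->
  \esum_(i in [set: I]) a i = \sum_(i <- A) a i.
Proof.
move=> a0 aA.
rewrite (_ : \esum_(i in _) _ = \esum_(i in [set` A]) a i).
  rewrite esum_fset ?finite_fset//.
  by rewrite fsbig_finite ?finite_fset//= set_fsetK.
rewrite [RHS]esum_mkcond; apply: eq_esum => i _.
by case: ifPn => // /negP iA; apply: aA; apply/negP => H; apply: iA; rewrite inE.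
Qed.

Lemma esum_single I (a : I -> \bar R) k :
  (forall i, 0 <= a i) -> (forall i, i != k -> a i = 0) ->
  \esum_(i in [set: I]) a i = a k.
Proof.
move=> a0 ak; rewrite (@esum_finsupp _ _ [fset k]%fset) ?big_seq_fset1//.
by move=> i; rewrite inE => /ak.
Qed.

Lemma esum_nat_le (a : nat -> R) (B : R) :
  (forall n, (0 <= a n)%R) -> (forall n, (\sum_(k < n) a k <= B)%R) ->
  \esum_(n in [set: nat]) (a n)%:E <= B%:E.
Proof.
move=> a0 aB; rewrite -nneseries_esumT; last by move=> n; rewrite lee_fin.
apply: lime_le.
  by apply: is_cvg_nneseries => n _ _; rewrite lee_fin.
apply: nearW => n; rewrite sumEFin lee_fin big_mkord; exact: aB.
Qed.

End NonnegativeSums.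

Section AbsolutelyConvergentSums.
Variable R : realType.
Local Notation C := R[i].
Implicit Types I J : choiceType.

Definition asum I (a : I -> C) : \bar R :=
  \esum_(i in [set: I]) (cabs (a i))%:E.

Definition abs_summable I (a : I -> C) : Prop := (asum a < +oo)%E.

(** The limit of the net of finite partial sums; its value is only meaningful when that net
    converges, for instance under [abs_summable]. *)
Definition csum I (a : I -> C) : C := summability.sum a.

Lemma asum_ge0 I (a : I -> C) : (0 <= asum a)%E.
Proof. by apply: esum_ge0 => i _; rewrite lee_fin cabs_ge0. Qed.

Lemma asum_fin_num I (a : I -> C) : abs_summable a -> asum a \is a fin_num.
Proof. by move=> sa; rewrite ge0_fin_numE// asum_ge0. Qed.

Lemma asumD I (a b : I -> C) : (asum (a \+ b)%R <= asum a + asum b)%E.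
Proof.
rewrite /asum -esumD; try by move=> i _; rewrite lee_fin cabs_ge0.
by apply: le_esum => i _; rewrite -EFinD lee_fin cabsD.
Qed.

Lemma asumZ I (z : C) (a : I -> C) :
  (asum (fun i => z * a i)%R <= (cabs z)%:E * asum a)%E.
Proof.
apply: le_trans (esumZl_le _ _); rewrite ?cabs_ge0//.
  by apply: le_esum => s _; rewrite -EFinM cabsM.
by move=> s; rewrite lee_fin cabs_ge0.
Qed.

Lemma le_asum I (a b : I -> C) :
  (forall i, cabs (a i) <= cabs (b i)) -> (asum a <= asum b)%E.
Proof. by move=> ab; apply: le_esum => i _; rewrite lee_fin. Qed.

Lemma cabs_le_asum I (a : I -> C) i : ((cabs (a i))%:E <= asum a)%E.
Proof. exact: (@esum_ge_term R I (fun i => (cabs (a i))%:E)). Qed.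

Lemma abs_summableD I (a b : I -> C) :
  abs_summable a -> abs_summable b -> abs_summable (a \+ b).
Proof.
by move=> sa sb; rewrite /abs_summable (le_lt_trans (asumD _ _))// lte_add_pinfty.
Qed.

Lemma abs_summableZ I (z : C) (a : I -> C) :
  abs_summable a -> abs_summable (fun i => z * a i).
Proof.
move=> sa; rewrite /abs_summable (le_lt_trans (asumZ _ _))//.
by rewrite lte_mul_pinfty// lee_fin cabs_ge0.
Qed.

Lemma le_abs_summable I (a b : I -> C) :
  (forall i, cabs (a i) <= cabs (b i)) -> abs_summable b -> abs_summable a.
Proof. by move=> ab; apply: le_lt_trans; exact: le_asum. Qed.

Lemma abs_summable_finsupp I (a : I -> C) (A : {fset I}) :
  (forall i, i \notin A -> a i = 0) -> abs_summable a.
Proof.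
move=> aA; rewrite /abs_summable /asum (@esum_finsupp _ _ _ A).
- by rewrite sumEFin ltry.
- by move=> i; rewrite lee_fin cabs_ge0.
- by move=> i /aA ->; rewrite cabs0.
Qed.

Lemma csum_cvg I (a : I -> C) :
  abs_summable a -> partial_sum a @ totally --> csum a.
Proof.
move=> sa.
exact: (@is_cvg_sum R I _ a (fun i => cabs (a i)) (fun i => normr_cabs (a i)) sa).
Qed.

Lemma csum_unique I (a : I -> C) (l : C) :
  partial_sum a @ totally --> l -> csum a = l.
Proof.
move=> al; apply: (@cvg_lim _ (@norm_hausdorff _ _) _ totally) => //.
Qed.

Lemma partial_sumE I (a : I -> C) (A : {fset I}) :
  partial_sum a A = \sum_(i <- A) a i.
Proof. by rewrite /partial_sum big_seq_fsetE. Qed.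

Lemma csum_le I (a : I -> C) :
  abs_summable a -> cabs (csum a) <= fine (asum a).
Proof.
move=> sa; rewrite -lecR -normr_cabs.
exact: (@sum_norm_le R I _ a (fun i => cabs (a i)) (fun i => normr_cabs (a i)) sa).
Qed.

Lemma csum_leE I (a : I -> C) : abs_summable a -> ((cabs (csum a))%:E <= asum a)%E.
Proof.
by move=> sa; rewrite -(fineK (asum_fin_num sa)) lee_fin csum_le.
Qed.

Lemma csumD I (a b : I -> C) : abs_summable a -> abs_summable b ->
  csum (a \+ b) = csum a + csum b.
Proof.
move=> sa sb; apply: csum_unique.
rewrite (_ : partial_sum _ = partial_sum a \+ partial_sum b); last first.
  by apply/funext => A /=; rewrite !partial_sumE big_split.
by apply: (@cvgD _ _ _ totally); exact: csum_cvg.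
Qed.

Lemma csumZ I (z : C) (a : I -> C) : abs_summable a ->
  csum (fun i => z * a i) = z * csum a.
Proof.
move=> sa; apply: csum_unique.
rewrite (_ : partial_sum _ = (fun A => z * partial_sum a A)); last first.
  by apply/funext => A /=; rewrite !partial_sumE mulr_sumr.
apply: (@cvgM _ _ totally); first exact: cvg_cst.
exact: csum_cvg.
Qed.

Lemma csum_finsupp I (a : I -> C) (A : {fset I}) :
  (forall i, i \notin A -> a i = 0) -> csum a = \sum_(i <- A) a i.
Proof.
move=> aA; apply: csum_unique; apply: (@cvg_near_cst _ _ _ _ totally).
exists A => // B /= AB; apply/eqP; rewrite partial_sumE.
rewrite (big_fsetID _ (mem A)) /= [X in _ + X]big1_seq ?addr0; last first.
  by move=> i; rewrite !inE /= => /andP[_ /aA].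
have -> // : [fset x | x in B & x \in A]%fset = A.
by apply/fsetP => i; rewrite !inE /= andb_idl// => /(fsubsetP AB).
Qed.

Lemma csum_single I (a : I -> C) k :
  (forall i, i != k -> a i = 0) -> csum a = a k.
Proof.
move=> ak; rewrite (@csum_finsupp _ _ [fset k]%fset) ?big_seq_fset1//.
by move=> i; rewrite inE => /ak.
Qed.

Lemma csum0 I (a : I -> C) : (forall i, a i = 0) -> csum a = 0.
Proof.
by move=> a0; rewrite (@csum_finsupp _ _ fset0) ?big_seq_fset0// => i _.
Qed.

(** In the order of the complex numbers 0 <= z means Im z = 0 and Re z >= 0; both are closed
    conditions, inherited from the partial sums. *)
Lemma csum_ge0 I (a : I -> C) :
  abs_summable a -> (forall i, 0 <= a i) -> 0 <= csum a.
Proof.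
move=> sa a0; have := csum_cvg sa => /(@cvgrPdist_lt _ _ _ totally) H.
have ac e : 0 < e -> exists2 y : C, 0 <= y & cabs (csum a - y) < e.
  rewrite -ltcR => /H [A _ /(_ A) /=]; rewrite fsubset_refl => /(_ isT).
  rewrite normr_cabs ltcR => ?; exists (partial_sum a A) => //.
  by rewrite partial_sumE sumr_ge0.
rewrite lecE; apply/andP; split.
  apply/eqP/normr0_eq0/eqP; rewrite eq_le normr_ge0 andbT.
  apply/ler_addgt0Pr => e /ac[y]; rewrite lecE /= => /andP[/eqP y0 _] ye.
  rewrite add0r; apply: ltW; apply: le_lt_trans ye.
  by apply: le_trans (normr_Im_le _); rewrite raddfB /= y0 subr0.
apply/ler_addgt0Pr => e /ac[y]; rewrite lecE /= => /andP[_ y0] ye.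
rewrite -lerBlDr sub0r; have := le_lt_trans (normr_Re_le _) ye.
by rewrite raddfB /= ltr_norml => /andP[+ _]; lra.
Qed.

(** A finite set A nearly attains the supremum defining [asum a], and [asum] is the sum of the
    masses on A and off A. *)
Lemma asum_tail I (a : I -> C) (e : R) : abs_summable a -> 0 < e ->
  exists A : {fset I}, (asum (fun i => if i \in A then 0 else a i)%R < e%:E)%E.
Proof.
move=> sa e0.
have : (asum a - e%:E < asum a)%E.
  rewrite -(fineK (asum_fin_num sa)) -EFinD lte_fin; lra.
rewrite {2}/asum => /ereal_sup_gt[_ [F0 [finF0 _] <-]].
rewrite fsbig_finite//=; set A := fset_set F0 => HA; exists A.
pose b i := if i \in A then a i else 0.
pose c i := if i \in A then 0 else a i.
have bc : asum a = (asum b + asum c)%E.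
  rewrite /asum -esumD; try by move=> i _; rewrite lee_fin cabs_ge0.
  apply: eq_esum => i _; rewrite /b /c; case: ifP => _.
    by rewrite cabs0 adde0.
  by rewrite cabs0 add0e.
have bE : asum b = (\sum_(i <- A) (cabs (a i))%:E)%E.
  rewrite /asum (@esum_finsupp _ _ _ A).
  - by rewrite big_seq [RHS]big_seq; apply: eq_bigr => i iA; rewrite /b iA.
  - by move=> i; rewrite lee_fin cabs_ge0.
  - by move=> i iA; rewrite /b (negbTE iA) cabs0.
have bfin : (asum b) \is a fin_num by rewrite bE sumEFin.
rewrite -/(asum _) -/c; move: HA; rewrite bc -bE.
have cfin : asum c \is a fin_num.
  rewrite ge0_fin_numE ?asum_ge0//; apply: le_lt_trans sa.
  by rewrite bc leeDr// asum_ge0.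
rewrite -(fineK bfin) -(fineK cfin) -!EFinD !lte_fin; lra.
Qed.

(* Finitely supported families are dense, so linear identities between sums   *)
(* (Fubini, reindexing) need only be checked on families supported at one     *)
(* point.                                                                     *)
Lemma csum_dense I (L : (I -> C) -> C) (K : R) :
  (forall a b, abs_summable a -> abs_summable b -> L (a \+ b) = L a + L b) ->
  (forall a, abs_summable a -> ((cabs (L a))%:E <= K%:E * asum a)%E) ->
  (forall a k, (forall i, i != k -> a i = 0) -> L a = 0) ->
  forall a, abs_summable a -> L a = 0.
Proof.
move=> LD LK L1 a sa.
have Lfin (A : {fset I}) b : (forall i, i \notin A -> b i = 0) -> L b = 0.
  elim/finSet_rect : A b => A IH b bA.
  have [A0|[k kA]] := fset_0Vmem A.
    (* Over an empty index type there is no point at which to apply the one-point hypothesis; there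
       b + b = b, and additivity gives L b = 0. *)
    have [[k _]|nI] := pselect (exists k : I, True).
      by apply: (L1 _ k) => i _; apply: bA; rewrite A0.
    have b0 : abs_summable b by apply: (@abs_summable_finsupp _ _ A).
    have := LD _ _ b0 b0; rewrite (_ : b \+ b = b).
      by move=> /eqP; rewrite -subr_eq subrr eq_sym => /eqP.
    by apply/funext => i; case: nI; exists i.
  pose c i := if i == k then b i else 0.
  pose d i := if i == k then 0 else b i.
  have dA i : i \notin (A `\ k)%fset -> d i = 0.
    by rewrite !inE negb_and negbK /d; case: eqP => //= _ /bA.
  have -> : b = c \+ d.
    by apply/funext => i; rewrite /c /d /=; case: eqP; rewrite (addr0, add0r).
  have cs : abs_summable c.
    apply: (@abs_summable_finsupp _ _ [fset k]%fset) => i.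
    by rewrite inE /c => /negbTE ->.
  rewrite LD//; last exact: abs_summable_finsupp dA.
  rewrite (L1 c k) ?(IH _ _ _ dA) ?addr0//; first exact: fproperD1.
  by move=> i; rewrite /c => /negbTE ->.
apply: cabs_eq0; apply/eqP; rewrite eq_le cabs_ge0 andbT.
apply/ler_addgt0Pr => e e0; rewrite add0r.
(* No sign is assumed for K; [|K| + 1] is a positive majorant to divide by. *)
have [|A HA] := @asum_tail _ a (e / (`|K| + 1)) sa; first by rewrite divr_gt0.
pose c i := if i \in A then a i else 0.
pose d i := if i \in A then 0 else a i.
have -> : a = c \+ d.
  by apply/funext => i; rewrite /c /d /=; case: ifP; rewrite (addr0, add0r).
have cA i : i \notin A -> c i = 0 by rewrite /c => /negbTE ->.
have sd : abs_summable d by apply: lt_trans HA _; rewrite ltry.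
rewrite LD//; last exact: abs_summable_finsupp cA.
rewrite (Lfin A)// add0r -lee_fin (le_trans (LK _ sd))//.
rewrite -(fineK (asum_fin_num sd)) -EFinM lee_fin.
move: HA; rewrite -/d -(fineK (asum_fin_num sd)) lte_fin => /ltW HA.
apply: (@le_trans _ _ (`|K| * fine (asum d))).
  by apply: ler_wpM2r; [exact: (fine_ge0 (asum_ge0 d))|exact: ler_norm].
apply: (@le_trans _ _ ((`|K| + 1) * fine (asum d))).
  by apply: ler_wpM2r; [exact: (fine_ge0 (asum_ge0 d))|rewrite lerDl].
by rewrite mulrC -ler_pdivlMr.
Qed.

Lemma asum_prod I J (a : I * J -> C) :
  asum a = (\esum_(i in [set: I]) asum (fun j => a (i, j)))%E.
Proof.
rewrite /asum esum_esum; last by move=> i j _ _; rewrite lee_fin cabs_ge0.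
rewrite (_ : _ `*`` _ = setT); first by apply: eq_esum => -[].
by apply/seteqP; split.
Qed.

Lemma asum_prod_swap I J (a : I * J -> C) :
  asum a = asum (fun p : J * I => a (p.2, p.1)).
Proof.
rewrite !asum_prod /asum esum_swap// => i j; rewrite lee_fin cabs_ge0//.
Qed.

Lemma abs_summable_row I J (a : I * J -> C) i :
  abs_summable a -> abs_summable (fun j => a (i, j)).
Proof.
apply: le_lt_trans; rewrite asum_prod.
exact: (@esum_ge_term R I (fun i => asum (fun j => a (i, j)))).
Qed.

Lemma asum_csum_le I J (a : I * J -> C) : abs_summable a ->
  (asum (fun i => csum (fun j => a (i, j))) <= asum a)%E.
Proof.
move=> sa; rewrite [leRHS]asum_prod; apply: le_esum => i _.
exact/csum_leE/abs_summable_row.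
Qed.

Lemma abs_summable_csum I J (a : I * J -> C) : abs_summable a ->
  abs_summable (fun i => csum (fun j => a (i, j))).
Proof. by move=> sa; exact: le_lt_trans (asum_csum_le sa) sa. Qed.

Lemma abs_summable_swap I J (a : I * J -> C) : abs_summable a ->
  abs_summable (fun p : J * I => a (p.2, p.1)).
Proof. by rewrite /abs_summable asum_prod_swap. Qed.

Lemma csum_swap I J (a : I -> J -> C) :
  abs_summable (fun p : I * J => a p.1 p.2) ->
  csum (fun i => csum (fun j => a i j)) = csum (fun j => csum (fun i => a i j)).
Proof.
move=> sa; apply/eqP; rewrite -subr_eq0; apply/eqP.
pose L (b : I * J -> C) := csum (fun i => csum (fun j => b (i, j))) -
  csum (fun j => csum (fun i => b (i, j))).
(* The constant is 2 because each of the two iterated sums is bounded by the norm of the double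
   family. *)
apply: (@csum_dense _ L 2 _ _ _ _ sa) => {sa a}.
- move=> a b sa sb; rewrite /L.
  rewrite (_ : (fun i => _) = (fun i => csum (fun j => a (i, j))) \+
      (fun i => csum (fun j => b (i, j)))); last first.
    by apply/funext => i; rewrite /= -csumD//; exact: abs_summable_row.
  rewrite csumD; try exact: abs_summable_csum.
  rewrite [X in _ - csum X](_ : _ = (fun j => csum (fun i => a (i, j))) \+
      (fun j => csum (fun i => b (i, j)))); last first.
    apply/funext => i; rewrite /= -csumD//;
      exact: (abs_summable_row _ (abs_summable_swap _)).
  rewrite csumD; try exact: (abs_summable_csum (abs_summable_swap _)).
  by rewrite opprD addrACA.
- move=> a sa; rewrite /L.
  have sa' := abs_summable_swap sa.
  apply: (@le_trans _ _ (asum a + asum a)%E); last first.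
    by rewrite -(fineK (asum_fin_num sa)) -EFinD -EFinM lee_fin; lra.
  apply: (le_trans (_ : (_ <= (cabs (csum (fun i => csum (fun j => a (i, j)))))%:E
    + (cabs (csum (fun j => csum (fun i => a (i, j)))))%:E)%E)).
    by rewrite -EFinD lee_fin (le_trans (cabsD _ _))// cabsN.
  apply: leeD.
    apply: le_trans (asum_csum_le sa).
    exact/csum_leE/abs_summable_csum.
  rewrite asum_prod_swap; apply: le_trans (asum_csum_le sa').
  exact/csum_leE/(abs_summable_csum sa').
- move=> a [k l] akl; rewrite /L.
  rewrite (@csum_single _ _ k); last first.
    move=> i ik; apply: csum0 => j; apply: akl.
    by apply: contra ik => /eqP[->].
  rewrite (@csum_single _ _ l); last first.
    by move=> j jl; apply: akl; apply: contra jl => /eqP[->].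
  rewrite (@csum_single _ _ l); last first.
    move=> i ik; apply: csum0 => j; apply: akl.
    by apply: contra ik => /eqP[_ ->].
  rewrite (@csum_single _ _ k) ?subrr//.
  by move=> j jl; apply: akl; apply: contra jl => /eqP[->].
Qed.

Lemma asum_reindex I J (e : J -> I) (e' : I -> J) (a : I -> C) :
  cancel e e' -> cancel e' e -> asum (a \o e) = asum a.
Proof.
move=> ee' e'e; apply/esym/(@reindex_esum _ _ _ setT setT e).
by split=> // [x y _ _ /(can_inj ee')//|x _]; exists (e' x).
Qed.

Lemma csum_reindex I J (e : J -> I) (e' : I -> J) (a : I -> C) :
  cancel e e' -> cancel e' e -> abs_summable a -> csum (a \o e) = csum a.
Proof.
move=> ee' e'e sa; apply/eqP; rewrite -subr_eq0; apply/eqP.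
have se b : abs_summable b -> abs_summable (b \o e).
  by rewrite /abs_summable (asum_reindex _ ee' e'e).
pose L (b : I -> C) := csum (b \o e) - csum b.
apply: (@csum_dense _ L 2 _ _ _ _ sa) => {sa a}.
- move=> a b sa sb; rewrite /L csumD//.
  rewrite (_ : _ \o e = (a \o e) \+ (b \o e)) ?csumD ?opprD 1?addrACA//; exact: se.
- move=> a sa; rewrite /L; have sae := se _ sa.
  apply: (@le_trans _ _ (asum a + asum a)%E); last first.
    by rewrite -(fineK (asum_fin_num sa)) -EFinD -EFinM lee_fin; lra.
  apply: (le_trans (_ : (_ <= (cabs (csum (a \o e)))%:E + (cabs (csum a))%:E)%E)).
    by rewrite -EFinD lee_fin (le_trans (cabsD _ _))// cabsN.
  apply: leeD; last exact: csum_leE.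
  by rewrite -(asum_reindex _ ee' e'e); exact: csum_leE.
- move=> a k ak; rewrite /L (@csum_single _ a k)//.
  rewrite (@csum_single _ _ (e' k)) /= ?e'e ?subrr//.
  by move=> i ik; apply: ak; apply: contra ik => /eqP <-; rewrite ee'.
Qed.

End AbsolutelyConvergentSums.

(** * Conjugation and Cauchy products of sums *)

Section CauchyProduct.
Variable R : realType.
Local Notation C := R[i].

Lemma csum_conj (I : choiceType) (a : I -> C) : abs_summable a ->
  csum (fun i => (a i)^*%C) = (csum a)^*%C.
Proof.
move=> sa; apply/eqP; rewrite -subr_eq0; apply/eqP.
have asumJ (b : I -> C) : asum (fun i => (b i)^*%C) = asum b.
  by apply: eq_esum => i _; rewrite cabs_conj.
pose L (b : I -> C) := csum (fun i => (b i)^*%C) - (csum b)^*%C.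
apply: (@csum_dense _ _ L 2 _ _ _ _ sa) => {sa a}.
- move=> a b sa sb; rewrite /L (csumD sa sb).
  rewrite (_ : (fun i => _) = (fun i => (a i)^*%C) \+ (fun i => (b i)^*%C)).
    by rewrite csumD /abs_summable ?asumJ// rmorphD opprD addrACA.
  by apply/funext => i; rewrite /= rmorphD.
- move=> a sa; rewrite /L.
  apply: (@le_trans _ _ (asum a + asum a)%E); last first.
    by rewrite -(fineK (asum_fin_num sa)) -EFinD -EFinM lee_fin; lra.
  apply: (le_trans (_ : (_ <= (cabs (csum (fun i => (a i)^*%C)))%:E
    + (cabs (csum a))%:E)%E)).
    by rewrite -EFinD lee_fin (le_trans (cabsD _ _))// cabsN cabs_conj.
  apply: leeD; last exact: csum_leE.
  by rewrite -(asumJ a); apply: csum_leE; rewrite /abs_summable asumJ.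
- move=> a k ak; rewrite /L (@csum_single _ _ a k)// (@csum_single _ _ _ k).
    by rewrite subrr.
  by move=> i /ak ->; rewrite rmorph0.
Qed.

Lemma csum_nat (n : nat) (a : nat -> C) :
  (forall k, (n <= k)%N -> a k = 0) -> csum a = \sum_(k < n) a k.
Proof.
move=> an; rewrite (@csum_finsupp _ _ _ [fset val k | k in 'I_n]%fset).
  rewrite big_imfset /=; last by move=> ? ? _ _ /val_inj.
  by rewrite big_enum.
move=> k /negP kn; apply: an; rewrite leqNgt; apply/negP => lt_kn; apply: kn.
by apply/imfsetP; exists (Ordinal lt_kn).
Qed.

(** Spread c over the triples (k, l, n) with n = k + l. Summing out n returns the double series,
    summing out l leaves the entry [e k n] of the nth antidiagonal, and two exchanges of summation
    join the two. *)
Lemma csum_cauchy (c : nat -> nat -> C) :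
  abs_summable (fun p : nat * nat => c p.1 p.2) ->
  csum (fun k => csum (fun l => c k l)) =
  csum (fun n => \sum_(k < n.+1) c k (n - k)%N).
Proof.
move=> sc.
pose d k l n := if n == (k + l)%N then c k l else 0.
pose e k n := if (k <= n)%N then c k (n - k)%N else 0.
have ad k : asum (fun p : nat * nat => d k p.1 p.2) = asum (fun l => c k l).
  rewrite asum_prod; apply: eq_esum => l _.
  rewrite /asum (@esum_single _ _ _ (k + l)%N) /= /d ?eqxx//.
    by move=> i; rewrite lee_fin cabs_ge0.
  by move=> i /negbTE ->; rewrite cabs0.
have sd k : abs_summable (fun p : nat * nat => d k p.1 p.2).
  by rewrite /abs_summable ad; exact: (abs_summable_row k sc).
have de k n : csum (fun l => d k l n) = e k n.
  rewrite /e; case: leqP => kn.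
    rewrite (@csum_single _ _ _ (n - k)%N) /d ?subnKC ?eqxx// => l.
    by case: (n =P (k + l)%N) => // ->; rewrite addKn eqxx.
  by apply: csum0 => l; rewrite /d; case: eqP => // E; move: kn; rewrite E ltnNge leq_addr.
transitivity (csum (fun k => csum (fun n => e k n))).
  congr csum; apply/funext => k.
  transitivity (csum (fun l => csum (fun n => d k l n))).
    congr csum; apply/funext => l.
    by rewrite (@csum_single _ _ _ (k + l)%N) /d ?eqxx// => n /negbTE ->.
  by rewrite csum_swap//; congr csum; apply/funext => n.
rewrite csum_swap; last first.
  rewrite /abs_summable asum_prod; apply: le_lt_trans sc.
  rewrite [leRHS]asum_prod; apply: le_esum => k _ /=; rewrite -ad.
  rewrite (_ : (fun n => e k n) = fun n => csum (fun l => d k l n)); last first.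
    by apply/funext => n; rewrite de.
  rewrite asum_prod_swap.
  exact: (asum_csum_le (abs_summable_swap (sd k))).
congr csum; apply/funext => n.
rewrite (@csum_nat n.+1) /e; last by move=> k; rewrite ltnNge => /negbTE ->.
by apply: eq_bigr => k _; rewrite -ltnS ltn_ord.
Qed.

End CauchyProduct.

(** * The convolution algebra l1(G) *)

Section GroupAlgebra.
Variables (R : realType) (G : zmodType).
Local Notation C := R[i].

Definition l1g_pred : {pred G -> C} := fun f => (asum f < +oo)%E.

Fact l1g_pred_submod : submod_closed l1g_pred.
Proof.
split.
  rewrite unfold_in; apply: (@abs_summable_finsupp _ _ _ fset0) => i _ //.
move=> z f g; rewrite !unfold_in => sf sg.
exact: (abs_summableD (abs_summableZ z sf) sg).
Qed.

HB.instance Definition _ :=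
  GRing.isSubmodClosed.Build C (G -> C) l1g_pred l1g_pred_submod.

Record l1g := L1g { l1g_val :> G -> C; _ : l1g_val \in l1g_pred }.

HB.instance Definition _ := [isSub for l1g_val].
HB.instance Definition _ := [Choice of l1g by <:].
HB.instance Definition _ := [SubChoice_isSubLmodule of l1g by <:].

Implicit Types f g h : l1g.

Lemma l1gP f : abs_summable f.
Proof. exact: valP f. Qed.

Lemma l1g_ext f g : f =1 g -> f = g.
Proof. by move=> fg; apply/val_inj/funext. Qed.

Lemma l1g0E s : (0 : l1g) s = 0. Proof. by []. Qed.
Lemma l1gDE f g s : (f + g) s = f s + g s. Proof. by []. Qed.
Lemma l1gBE f g s : (f - g) s = f s - g s. Proof. by []. Qed.
Lemma l1gZE z f s : (z *: f) s = z * f s. Proof. by []. Qed.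

Lemma l1g_sumE (I : Type) (r : seq I) (P : pred I) (F : I -> l1g) s :
  (\sum_(i <- r | P i) F i) s = \sum_(i <- r | P i) F i s.
Proof. by elim/big_rec2 : _ => [//|i y z _ <-]; rewrite l1gDE. Qed.

Definition nrm f : R := fine (asum f).

Lemma nrmE f : asum f = (nrm f)%:E.
Proof. by rewrite /nrm fineK// asum_fin_num//; exact: l1gP. Qed.

Lemma nrm_ge0 f : 0 <= nrm f.
Proof. by rewrite -lee_fin -nrmE asum_ge0. Qed.

Lemma cabs_le_nrm f s : cabs (f s) <= nrm f.
Proof. by rewrite -lee_fin -nrmE cabs_le_asum. Qed.

Lemma nrmD f g : nrm (f + g) <= nrm f + nrm g.
Proof. by rewrite -lee_fin EFinD -!nrmE; exact: asumD. Qed.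

Lemma nrmZ z f : nrm (z *: f) <= cabs z * nrm f.
Proof. by rewrite -lee_fin EFinM -!nrmE; exact: asumZ. Qed.

(** Translating each row makes this a product of two sums. [esumZl_le] pulls a scalar out in one
    direction only; the other direction applies it to the inverse scalar, with the scalar 0 treated
    apart. *)
Lemma asum_conv f g :
  asum (fun p : G * G => f p.1 * g (p.2 - p.1)) = (nrm f * nrm g)%:E.
Proof.
rewrite asum_prod /=.
transitivity (\esum_(t in [set: G]) ((nrm g)%:E * (cabs (f t))%:E))%E.
  apply: eq_esum => t _.
  transitivity (asum (fun s => f t * g s)).
    exact: (@asum_reindex R G G (fun s => s - t) (fun s => s + t)
      (fun s => f t * g s) (subrK t) (addrK t)).
  rewrite /asum; under eq_esum do rewrite cabsM EFinM.
  apply/eqP; rewrite eq_le; apply/andP; split.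
    apply: le_trans (esumZl_le _ _) _; rewrite ?cabs_ge0//.
      by move=> s; rewrite lee_fin cabs_ge0.
    by rewrite -/(asum g) nrmE muleC.
  have [ft0|ft0] := eqVneq (f t) 0.
    by rewrite ft0 cabs0 mule0 esum_ge0// => s _; rewrite mul0e.
  have ft : 0 < cabs (f t).
    by rewrite lt0r cabs_ge0 andbT; apply: contra ft0 => /eqP/cabs_eq0 ->.
  rewrite muleC -lee_pdivlMl// -nrmE.
  apply: le_trans (esumZl_le _ _).
  - by apply: le_esum => s _; rewrite -!EFinM lee_fin mulrA mulVf ?mul1r// gt_eqF.
  - by rewrite invr_ge0 cabs_ge0.
  - by move=> s; rewrite -EFinM lee_fin mulr_ge0 ?cabs_ge0.
apply/eqP; rewrite eq_le; apply/andP; split.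
  apply: le_trans (esumZl_le _ _) _; rewrite ?nrm_ge0//.
    by move=> s; rewrite lee_fin cabs_ge0.
  by rewrite -/(asum f) nrmE -EFinM mulrC.
have [g0|g0] := eqVneq (nrm g) 0.
  rewrite g0 mulr0 esum_ge0// => s _; by rewrite mul0e.
have gt : 0 < nrm g by rewrite lt0r g0 nrm_ge0.
rewrite mulrC EFinM -lee_pdivlMl// -(nrmE f).
apply: le_trans (esumZl_le _ _).
- by apply: le_esum => s _; rewrite -!EFinM lee_fin mulrA mulVf ?mul1r// gt_eqF.
- by rewrite invr_ge0 ltW.
- by move=> s; rewrite -EFinM lee_fin mulr_ge0 ?cabs_ge0 ?nrm_ge0.
Qed.

Lemma abs_summable_conv f g :
  abs_summable (fun p : G * G => f p.1 * g (p.2 - p.1)).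
Proof. by rewrite /abs_summable asum_conv ltry. Qed.

Fact conv_subproof f g : (fun s => csum (fun t => f t * g (s - t))) \in l1g_pred.
Proof.
rewrite unfold_in.
exact: (abs_summable_csum (abs_summable_swap (abs_summable_conv f g))).
Qed.

Definition conv f g : l1g := L1g (conv_subproof f g).

Lemma convE f g s : conv f g s = csum (fun t => f t * g (s - t)).
Proof. by []. Qed.

Lemma abs_summable_conv_at f g s : abs_summable (fun t => f t * g (s - t)).
Proof. exact: (abs_summable_row s (abs_summable_swap (abs_summable_conv f g))). Qed.

Lemma convC : commutative conv.
Proof.
move=> f g; apply: l1g_ext => s; rewrite !convE.
have K : cancel (fun t => s - t) (fun t => s - t) by move=> t; rewrite subKr.
rewrite -(csum_reindex K K (abs_summable_conv_at g f s)).
by congr csum; apply/funext => t /=; rewrite subKr mulrC.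
Qed.

Lemma convA : associative conv.
Proof.
move=> f g h; apply: l1g_ext => s; rewrite !convE.
transitivity (csum (fun u => csum (fun t => f u * g (t - u) * h (s - t)))).
  congr csum; apply/funext => u; rewrite convE -csumZ; last first.
    exact: abs_summable_conv_at.
  rewrite -(@csum_reindex _ _ _ (fun t => t - u) (fun t => t + u)
    (fun t => f u * (g t * h (s - u - t)))).
  - by congr csum; apply/funext => t /=; rewrite mulrA opprB addrA subrK.
  - by move=> t; rewrite subrK.
  - by move=> t; rewrite addrK.
  - exact/abs_summableZ/abs_summable_conv_at.
rewrite csum_swap.
  congr csum; apply/funext => t; rewrite convE mulrC -csumZ; last first.
    exact: abs_summable_conv_at.
  by congr csum; apply/funext => u; rewrite mulrC.
(* Bounding h by its norm dominates the triple product by the summable family of f and g. *)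
apply: le_abs_summable (abs_summableZ (nrm h)%:C (abs_summable_conv f g)) => p.
rewrite /= cabsM [leRHS]cabsM mulrC ler_wpM2r ?cabs_ge0//.
rewrite (le_trans (cabs_le_nrm _ _))//.
by rewrite -lecR -normr_cabs ger0_norm// ler0c nrm_ge0.
Qed.

Fact delta0_subproof : (fun s : G => (s == 0)%:R : C) \in l1g_pred.
Proof.
rewrite unfold_in; apply: (@abs_summable_finsupp _ _ _ [fset 0]%fset) => s.
by rewrite inE => /negbTE ->.
Qed.

Definition delta0 : l1g := L1g delta0_subproof.

Lemma conv1 : left_id delta0 conv.
Proof.
move=> f; apply: l1g_ext => s; rewrite convE (@csum_single _ _ _ 0) /=.
  by rewrite eqxx mul1r subr0.
by move=> t /negbTE ->; rewrite mul0r.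
Qed.

Lemma convDl : left_distributive conv +%R.
Proof.
move=> f g h; apply: l1g_ext => s; rewrite l1gDE !convE.
rewrite -csumD; try exact: abs_summable_conv_at.
congr csum; apply/funext => t; exact: mulrDl.
Qed.

Fact delta0_neq0 : delta0 != 0.
Proof.
apply/eqP => /(congr1 (fun f : l1g => f 0)) /eqP.
by rewrite /= eqxx oner_eq0.
Qed.

HB.instance Definition _ :=
  GRing.Zmodule_isComNzRing.Build l1g convA convC conv1 convDl delta0_neq0.

Lemma l1gME f g s : (f * g) s = csum (fun t => f t * g (s - t)).
Proof. by []. Qed.

Lemma l1g1E s : (1 : l1g) s = (s == 0)%:R.
Proof. by []. Qed.

Fact convZl z f g : z *: (f * g) = (z *: f) * g.
Proof.
apply: l1g_ext => s; rewrite l1gZE !l1gME -csumZ.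
  by congr csum; apply/funext => t; rewrite l1gZE mulrA.
exact: abs_summable_conv_at.
Qed.

HB.instance Definition _ := GRing.Lmodule_isLalgebra.Build C l1g convZl.
HB.instance Definition _ := GRing.Lalgebra_isComAlgebra.Build C l1g.

Lemma nrmM f g : nrm (f * g) <= nrm f * nrm g.
Proof.
rewrite -lee_fin -nrmE -asum_conv asum_prod_swap.
exact: (asum_csum_le (abs_summable_swap (abs_summable_conv f g))).
Qed.

Lemma nrm1 : nrm 1 = 1.
Proof.
apply: EFin_inj; rewrite -nrmE /asum (@esum_single _ _ _ 0).
- by rewrite /= eqxx /cabs Normc.normc1.
- by move=> i; rewrite lee_fin cabs_ge0.
- by move=> i /= /negbTE ->; rewrite cabs0.
Qed.

Lemma nrmX f k : nrm (f ^+ k) <= nrm f ^+ k.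
Proof.
elim: k => [|k IH]; first by rewrite !expr0 nrm1.
by rewrite !exprS (le_trans (nrmM _ _))// ler_wpM2l ?nrm_ge0.
Qed.

End GroupAlgebra.

(** * Norm-convergent series and the exponential *)

Section Series.
Variables (R : realType) (G : zmodType).
Local Notation C := R[i].
Local Notation A := (l1g R G).
Implicit Types (I : choiceType) (f g x y : A).

(** Summability of the norms ([asum_family]), phrased jointly over the index and the group so that
    [csum_swap] applies directly. *)
Definition nsummable I (b : I -> A) : Prop :=
  abs_summable (fun p : I * G => b p.1 p.2).

Lemma asum_family I (b : I -> A) :
  asum (fun p : I * G => b p.1 p.2) = (\esum_(i in [set: I]) (nrm (b i))%:E)%E.
Proof. by rewrite asum_prod; apply: eq_esum => i _; rewrite -nrmE. Qed.

Lemma nsummableP I (b : I -> A) :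
  (\esum_(i in [set: I]) (nrm (b i))%:E < +oo)%E -> nsummable b.
Proof. by rewrite /nsummable /abs_summable asum_family. Qed.

(** A pointwise sum; 0 is the default when the result is not in l1(G), which [bsumE] excludes for
    [nsummable] families. *)
Definition bsum I (b : I -> A) : A := insubd 0 (fun s => csum (fun i => b i s)).

Lemma bsumE I (b : I -> A) s : nsummable b -> bsum b s = csum (fun i => b i s).
Proof.
move=> sb; rewrite /bsum val_insubd ifT// unfold_in.
exact: (abs_summable_csum (abs_summable_swap sb)).
Qed.

Lemma nrm_bsum_le I (b : I -> A) : nsummable b ->
  ((nrm (bsum b))%:E <= \esum_(i in [set: I]) (nrm (b i))%:E)%E.
Proof.
move=> sb; rewrite -asum_family -nrmE asum_prod_swap.
rewrite (_ : asum (bsum b) = asum (fun s => csum (fun i => b i s))).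
  exact: (asum_csum_le (abs_summable_swap sb)).
by congr asum; apply/funext => s; rewrite bsumE.
Qed.

Lemma nsummable_col I (b : I -> A) s : nsummable b -> abs_summable (fun i => b i s).
Proof. by move=> sb; exact: (abs_summable_row s (abs_summable_swap sb)). Qed.

Lemma nsummableMl I (b : I -> A) y : nsummable b -> nsummable (fun i => y * b i).
Proof.
rewrite /nsummable /abs_summable (asum_family b) => sb.
rewrite (asum_family (fun i => y * b i)).
apply: (@le_lt_trans _ _ (\esum_(i in [set: I]) ((nrm y)%:E * (nrm (b i))%:E))%E).
  by apply: le_esum => i _; rewrite -EFinM lee_fin nrmM.
apply: le_lt_trans (esumZl_le _ _) _; rewrite ?nrm_ge0//.
  by move=> i; rewrite lee_fin nrm_ge0.
by rewrite lte_mul_pinfty// lee_fin nrm_ge0.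
Qed.

Lemma mulr_bsum I (b : I -> A) y : nsummable b ->
  y * bsum b = bsum (fun i => y * b i).
Proof.
move=> sb; apply: l1g_ext => s.
rewrite bsumE ?l1gME; last exact: nsummableMl.
transitivity (csum (fun t => csum (fun i => y t * b i (s - t)))).
  congr csum; apply/funext => t; rewrite bsumE// csumZ//.
  exact: nsummable_col.
rewrite csum_swap//.
pose a := fun p : G * I => y p.1 * b p.2 (s - p.1).
rewrite /abs_summable -/a (asum_prod_swap a) asum_prod /=.
move: sb; rewrite /nsummable /abs_summable (asum_family b) => sb.
apply: (@le_lt_trans _ _ (\esum_(i in [set: I]) ((nrm y)%:E * (nrm (b i))%:E))%E).
  apply: le_esum => i _; rewrite -EFinM -asum_conv asum_prod_swap asum_prod.
  exact: (@esum_ge_term R G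
    (fun s => asum (fun t => (fun p : G * G => y p.2 * b i (p.1 - p.2)) (s, t)))).
apply: le_lt_trans (esumZl_le _ _) _; rewrite ?nrm_ge0//.
  by move=> i; rewrite lee_fin nrm_ge0.
by rewrite lte_mul_pinfty// lee_fin nrm_ge0.
Qed.


Lemma cabsR (r : R) : cabs r%:C = `|r|.
Proof. by rewrite /cabs /= expr0n /= addr0 sqrtr_sqr. Qed.

Lemma nrm0 : nrm (0 : A) = 0.
Proof.
apply: EFin_inj; rewrite -nrmE /asum esum1// => s _.
by rewrite l1g0E cabs0.
Qed.

Lemma nsummable_mask I (b : I -> A) (P : pred I) :
  nsummable b -> nsummable (fun i => if P i then 0 else b i).
Proof.
move=> sb; apply: nsummableP; apply: le_lt_trans sb; rewrite asum_family.
apply: le_esum => i _; rewrite lee_fin; case: ifP => // _.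
by rewrite nrm0 nrm_ge0.
Qed.

Lemma bsum_split (b : nat -> A) n : nsummable b ->
  bsum b - \sum_(k < n) b k = bsum (fun k => if (k < n)%N then 0 else b k).
Proof.
move=> sb; apply: l1g_ext => s; rewrite l1gBE bsumE// bsumE; last first.
  exact: (nsummable_mask (fun k => k < n)%N).
pose d k := if (k < n)%N then b k s else 0.
have dn k : (n <= k)%N -> d k = 0.
  by move=> nk; rewrite /d ifF//; apply/negbTE; rewrite -leqNgt.
rewrite (_ : (fun k : nat => b k s) =
  d \+ (fun k => (if (k < n)%N then 0 else b k) s)); last first.
  by apply/funext => k; rewrite /d /=; case: ifP; rewrite ?l1g0E ?addr0 ?add0r.
rewrite csumD; last exact: (nsummable_col s (nsummable_mask (fun k => k < n)%N sb)).
  rewrite (csum_nat dn) l1g_sumE.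
  rewrite (_ : \sum_(k < n) d k = \sum_(k < n) b k s); last first.
    by apply: eq_bigr => k _; rewrite /d ltn_ord.
  by rewrite addrAC subrr add0r.
apply: (@abs_summable_finsupp _ _ _ [fset val k | k in 'I_n]%fset).
move=> k /negP kn; apply: dn; rewrite leqNgt; apply/negP => lt_kn; apply: kn.
by apply/imfsetP; exists (Ordinal lt_kn).
Qed.

Lemma bsum_tail (b : nat -> A) (e : R) : nsummable b -> 0 < e ->
  exists n0, forall n, (n0 <= n)%N -> nrm (bsum b - \sum_(k < n) b k) <= e.
Proof.
move=> sb e0; pose a k : C := (nrm (b k))%:C.
have cabsa k : cabs (a k) = nrm (b k).
  by rewrite cabsR ger0_norm ?nrm_ge0.
have sa : abs_summable a.
  rewrite /abs_summable /asum; under eq_esum do rewrite cabsa.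
  by rewrite -asum_family.
(* Beyond the largest element of F the remaining norms sum to less than e. *)
have [F HF] := asum_tail sa e0; exists (\max_(k <- F) k).+1 => n Fn.
rewrite bsum_split// -lee_fin.
apply: (le_trans (nrm_bsum_le (nsummable_mask (fun k => k < n)%N sb))).
apply: le_trans (ltW HF); apply: le_esum => k _; rewrite lee_fin.
case: ifPn => kn; first by rewrite nrm0 cabs_ge0.
rewrite ifF ?cabsa//; apply/negbTE; apply: contra kn => kF.
by apply: leq_trans Fn; rewrite ltnS; apply: leq_bigmax_seq.
Qed.

Fact expl_key : unit. Proof. exact: tt. Qed.

(* Locked because unification otherwise unfolds the series.                   *)
Definition expl : A -> A := locked_with expl_key
  (fun x => bsum (fun k : nat => (k`!%:R^-1 : R)%:C *: x ^+ k)).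

Lemma expl_bsum x : expl x = bsum (fun k : nat => (k`!%:R^-1 : R)%:C *: x ^+ k).
Proof. by rewrite /expl unlock. Qed.

Lemma nrm_exp_coeff x k :
  nrm ((k`!%:R^-1 : R)%:C *: x ^+ k) <= nrm x ^+ k / k`!%:R.
Proof.
rewrite (le_trans (nrmZ _ _))// cabsR ger0_norm ?invr_ge0 ?ler0n// mulrC.
by rewrite ler_wpM2r ?invr_ge0 ?ler0n// nrmX.
Qed.

Lemma esum_exp_coeff (t : R) : 0 <= t ->
  (\esum_(k in [set: nat]) (t ^+ k / k`!%:R)%:E < +oo)%E.
Proof.
move=> t0; apply: (@le_lt_trans _ _ (expR t)%:E); last exact: ltry.
apply: esum_nat_le => [n|n]; first by rewrite mulr_ge0 ?exprn_ge0 ?invr_ge0 ?ler0n.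
rewrite (_ : \sum_(k < n) _ = series (exp_coeff t) n); last first.
  by rewrite /series /= big_mkord.
apply: (nondecreasing_cvgn_le _ (is_cvg_series_exp_coeff t)).
apply: nondecreasing_series => k _ _.
by rewrite /exp_coeff /= mulr_ge0 ?exprn_ge0 ?invr_ge0 ?ler0n.
Qed.

Lemma nsummable_exp x : nsummable (fun k : nat => (k`!%:R^-1 : R)%:C *: x ^+ k).
Proof.
apply: nsummableP; apply: le_lt_trans (esum_exp_coeff (nrm_ge0 x)).
by apply: le_esum => k _; rewrite lee_fin nrm_exp_coeff.
Qed.

Lemma explE x s : expl x s = csum (fun k : nat => (k`!%:R^-1 : R)%:C * (x ^+ k) s).
Proof. by rewrite expl_bsum bsumE//; exact: nsummable_exp. Qed.

Lemma abs_summable_expl x s :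
  abs_summable (fun k : nat => (k`!%:R^-1 : R)%:C * (x ^+ k) s).
Proof. exact: (nsummable_col s (nsummable_exp x)). Qed.

Lemma expl0 : expl 0 = 1.
Proof.
apply: l1g_ext => s; rewrite explE (@csum_single _ _ _ 0%N).
  by rewrite fact0 invr1 mul1r expr0.
by move=> k k0; rewrite expr0n (negbTE k0) l1g0E mulr0.
Qed.

(** Cauchy product of the two series, evaluated at a point; by the binomial theorem the nth
    antidiagonal sums to (x + y)^n / n!. *)
Lemma explD x y : expl (x + y) = expl x * expl y.
Proof.
pose b (x : A) k := (k`!%:R^-1 : R)%:C *: x ^+ k : A.
have sb z : nsummable (b z) by exact: nsummable_exp.
apply: l1g_ext => s.
rewrite [expl x * _]mulrC (expl_bsum x) (mulr_bsum _ (sb x)).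
rewrite (bsumE _ (nsummableMl _ (sb x))).
transitivity (csum (fun k => csum (fun l => (b x k * b y l) s))); last first.
  congr csum; apply/funext => k; rewrite mulrC (expl_bsum y) (mulr_bsum _ (sb y)).
  by rewrite (bsumE _ (nsummableMl _ (sb y))).
rewrite csum_cauchy; last first.
  rewrite /abs_summable asum_prod.
  have nb z : (\esum_(l in [set: nat]) (nrm (b z l))%:E < +oo)%E.
    by rewrite -asum_family; exact: sb.
  pose E := fine (\esum_(l in [set: nat]) (nrm (b y l))%:E).
  have E0 : (0 <= \esum_(l in [set: nat]) (nrm (b y l))%:E)%E.
    by apply: esum_ge0 => l _; rewrite lee_fin nrm_ge0.
  have EE : (\esum_(l in [set: nat]) (nrm (b y l))%:E)%E = E%:E.
    by rewrite fineK// ge0_fin_numE// nb.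
  apply: (@le_lt_trans _ _ (\esum_(k in [set: nat]) (E%:E * (nrm (b x k))%:E))%E).
    apply: le_esum => k _; rewrite -EE muleC.
    apply: le_trans (esumZl_le _ _).
    - by apply: le_esum => l _; rewrite -EFinM lee_fin (le_trans (cabs_le_nrm _ _))// nrmM.
    - exact: nrm_ge0.
    - by move=> l; rewrite lee_fin nrm_ge0.
  apply: le_lt_trans (esumZl_le _ _) _.
  - by rewrite -lee_fin -EE.
  - by move=> k; rewrite lee_fin nrm_ge0.
  - by rewrite lte_mul_pinfty// ?nb// -EE.
rewrite explE; congr csum; apply/funext => n.
rewrite (addrC x y) exprDn l1g_sumE mulr_sumr; apply: eq_bigr => k _.
rewrite /b -scalerAl -scalerAr scalerA l1gZE -(scaler_nat _ (y ^+ _ * _)) l1gZE mulrA.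
rewrite [y ^+ _ * _]mulrC; congr (_ * _).
rewrite (_ : 'C(n, k)%:R = ('C(n, k)%:R : R)%:C); last by rewrite rmorph_nat.
rewrite -!rmorphM; congr (_%:C).
have kn : (k <= n)%N by rewrite -ltnS.
rewrite -(bin_fact kn) !natrM !invfM mulrC !mulrA mulfV ?mul1r//.
by rewrite pnatr_eq0 -lt0n bin_gt0.
Qed.

(** As (n + 3)! >= 6 and t <= 1/2, the term of order n + 3 is at most t^3 / 6 times (1/2)^n, and
    this geometric series sums to t^3 / 3. *)
Lemma esum_exp_tail (t : R) : 0 <= t -> t <= 1 / 2 ->
  (\esum_(k in [set: nat]) (if (k < 3)%N then 0 else t ^+ k / k`!%:R)%:E
   <= (t ^+ 3 / 3)%:E)%E.
Proof.
move=> t0 t2; pose m k : R := if (k < 3)%N then 0 else t ^+ k / k`!%:R.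
have m0 k : 0 <= m k.
  rewrite /m; case: ifP => // _.
  by rewrite mulr_ge0 ?exprn_ge0 ?invr_ge0 ?ler0n.
have t3 : 0 <= t ^+ 3 by exact: exprn_ge0.
have mS n : \sum_(k < n.+3) m k <= t ^+ 3 / 3 * (1 - (1 / 2) ^+ n).
  elim: n => [|n IH].
    by rewrite !big_ord_recr big_ord0 /= /m /= expr0 subrr mulr0 !addr0.
  rewrite (_ : \sum_(k < n.+4) m k = \sum_(k < n.+3) m k + m n.+3); last first.
    by rewrite big_ord_recr.
  rewrite [(1 / 2) ^+ n.+1]exprS.
  suff : m n.+3 <= t ^+ 3 / 6 * (1 / 2) ^+ n.
    move: IH; set S := \sum_(k < _) _; set P := (1 / 2) ^+ n; set T := t ^+ 3.
    by clearbody S P T; lra.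
  rewrite /m /= -[n.+3]addn3 exprD mulrAC [_ * t ^+ 3]mulrC.
  rewrite -[leRHS]mulrA; apply: ler_wpM2l => //.
  rewrite [leLHS]mulrC; apply: ler_pM.
  - by rewrite invr_ge0 ler0n.
  - exact: exprn_ge0.
  - rewrite lef_pV2 ?posrE ?ltr0n ?fact_gt0// -[6]/(3`!%:R) ler_nat.
    by apply: leq_fact; rewrite leq_addl.
  - by rewrite lerXn2r ?nnegrE//; lra.
apply: esum_nat_le => // n.
apply: le_trans (_ : _ <= t ^+ 3 / 3 * (1 - (1 / 2) ^+ n)) _; last first.
  rewrite ler_piMr ?divr_ge0// gerBl exprn_ge0//; lra.
apply: le_trans (mS n).
by rewrite !big_ord_recr /= -!addrA lerDl !addr_ge0.
Qed.

Lemma nrm_exp_tail x : nrm x <= 1 / 2 ->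
  nrm (expl x - (1 + x + (1 / 2 : R)%:C *: x ^+ 2)) <= nrm x ^+ 3 / 3.
Proof.
move=> x2; have sb := nsummable_exp x; set b := (fun k : nat => _) in sb.
have -> : 1 + x + (1 / 2 : R)%:C *: x ^+ 2 = \sum_(k < 3) b k.
  transitivity (b 0%N + b 1%N + b 2%N).
    rewrite /b (_ : 2`! = 2)%N// (_ : 1`! = 1)%N// fact0 invr1 !scale1r.
    by rewrite expr0 expr1 mul1r.
  by rewrite !big_ord_recr big_ord0 /= add0r.
rewrite expl_bsum bsum_split// -lee_fin.
apply: (le_trans (nrm_bsum_le (nsummable_mask (fun k => k < 3)%N sb))).
apply: le_trans (esum_exp_tail (nrm_ge0 x) x2).
apply: le_esum => k _; rewrite lee_fin; case: ifP => _; first by rewrite nrm0.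
exact: nrm_exp_coeff.
Qed.

(** 1 + 1/2 + 1/8 + 1/24 < 2. *)
Lemma nrm_exp_le2 x : nrm x <= 1 / 2 -> nrm (expl x) <= 2.
Proof.
move=> x2; have t0 := nrm_ge0 x.
rewrite -[expl x](subrK (1 + x + (1 / 2 : R)%:C *: x ^+ 2)).
have h0 := nrm_exp_tail x2.
have h1 := nrmZ (1 / 2 : R)%:C (x ^+ 2); rewrite cabsR ger0_norm in h1; last by lra.
have h2 := nrmX x 2.
have h3 : nrm x ^+ 2 <= (1 / 2) ^+ 2 by rewrite lerXn2r// nnegrE.
have h4 : nrm x ^+ 3 <= (1 / 2) ^+ 3 by rewrite lerXn2r// nnegrE.
rewrite (le_trans (nrmD _ _))//.
have h5 := nrmD (1 + x) ((1 / 2 : R)%:C *: x ^+ 2).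
have h6 := nrmD 1 x; rewrite nrm1 in h6.
by lra.
Qed.

End Series.

(** * Involution, unitarity and supports *)

Section Involution.
Variables (R : realType) (G : zmodType).
Local Notation C := R[i].
Local Notation A := (l1g R G).
Implicit Types (f g x y : A).

Fact star_subproof f : (fun s => (f (- s))^*%C) \in @l1g_pred R G.
Proof.
rewrite unfold_in (_ : asum _ = asum f) ?(l1gP f)//.
transitivity (asum (f \o -%R)).
  by apply: eq_esum => s _; rewrite cabs_conj.
by apply: (@asum_reindex _ _ _ -%R -%R) => s; rewrite opprK.
Qed.

Definition star f : A := L1g (star_subproof f).

Lemma starE f s : star f s = (f (- s))^*%C. Proof. by []. Qed.

Lemma starD f g : star (f + g) = star f + star g.
Proof. by apply: l1g_ext => s; rewrite l1gDE !starE -rmorphD. Qed.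

Lemma starB f g : star (f - g) = star f - star g.
Proof. by apply: l1g_ext => s; rewrite l1gBE !starE -rmorphB. Qed.

Lemma starZ z f : star (z *: f) = z^*%C *: star f.
Proof. by apply: l1g_ext => s; rewrite l1gZE !starE -rmorphM. Qed.

Lemma star1 : star 1 = 1.
Proof.
by apply: l1g_ext => s; rewrite starE !l1g1E oppr_eq0 rmorph_nat.
Qed.

Lemma starM f g : star (f * g) = star f * star g.
Proof.
apply: l1g_ext => s; rewrite starE !l1gME -csum_conj; last first.
  exact: abs_summable_conv_at.
rewrite -(@csum_reindex _ _ _ -%R -%R).
- by congr csum; apply/funext => t; rewrite /= rmorphM opprD !opprK.
- exact: opprK.
- exact: opprK.
- rewrite /abs_summable /asum.
  by under eq_esum do rewrite cabs_conj; exact: abs_summable_conv_at.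
Qed.

Lemma starX f n : star (f ^+ n) = star f ^+ n.
Proof.
by elim: n => [|n IH]; rewrite ?expr0 ?star1// !exprS starM IH.
Qed.

Lemma star_expl x : star (expl x) = expl (star x).
Proof.
apply: l1g_ext => s; rewrite starE explE (explE (star x)) -csum_conj; last first.
  exact: abs_summable_expl.
congr csum; apply/funext => k; rewrite rmorphM -starX starE; congr (_ * _).
exact: conjc_real.
Qed.

Lemma conjci : ('i%C : C)^*%C = - 'i%C.
Proof. by apply/eqP; rewrite eq_complex /= oppr0 !eqxx. Qed.

(** P = exp(i x) is unitary, and the value at 0 of P times its adjoint is the sum of all [|P(t)|^2].
    This sum is 1, so no coefficient exceeds 1. *)
Lemma unitary_bound x s : star x = x -> cabs (expl ('i%C *: x) s) <= 1.
Proof.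
move=> sx; set P := expl _.
have PP : P * star P = 1.
  by rewrite star_expl starZ sx conjci scaleNr -explD subrr expl0.
have := congr1 (fun f : A => f 0) PP; rewrite l1gME l1g1E eqxx.
pose a t : C := P t * star P (0 - t).
have aE t : a t = (cabs (P t) ^+ 2)%:C.
  rewrite /a starE sub0r opprK rmorphXn /= -normr_cabs.
  by rewrite normCKC mulrC.
have sa : abs_summable a by exact: abs_summable_conv_at.
rewrite -/a => a1.
pose b t := if t == s then 0 else a t.
pose c t := if t == s then a t else 0.
have cE : csum c = a s.
  by rewrite (@csum_single _ _ _ s) /c ?eqxx// => t /negbTE ->.
have sb : abs_summable b.
  apply: le_abs_summable sa => t; rewrite /b; case: ifP => // _.
  by rewrite cabs0 cabs_ge0.
have sc : abs_summable c.
  apply: le_abs_summable sa => t; rewrite /c; case: ifP => // _.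
  by rewrite cabs0 cabs_ge0.
have b0 : 0 <= csum b.
  apply: csum_ge0 => // t; rewrite /b; case: ifP => // _.
  by rewrite aE ler0c sqr_ge0.
have : csum a = csum b + csum c.
  rewrite -csumD//; congr csum; apply/funext => t /=.
  by rewrite /b /c; case: ifP; rewrite (addr0, add0r).
rewrite a1 cE aE => e1.
have : (cabs (P s) ^+ 2)%:C <= true%:R :> C by rewrite e1 lerDr.
by rewrite (_ : true%:R = 1%:C)// lecR expr_le1// cabs_ge0.
Qed.

(** Realizes l1(H) inside l1(G), so that a single algebra serves for every subgroup. *)
Definition supported (H : set G) f : Prop := forall s, ~ H s -> f s = 0.

Section Supported.
Variable H : set G.
Hypotheses (H0 : H 0) (HD : forall s t, H s -> H t -> H (s + t)).

Lemma supported1 : supported H 1.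
Proof.
by move=> s Hs; rewrite l1g1E; case: eqP => // s0; case: Hs; rewrite s0.
Qed.

Lemma supportedD f g : supported H f -> supported H g -> supported H (f + g).
Proof. by move=> Hf Hg s Hs; rewrite l1gDE Hf// Hg// addr0. Qed.

Lemma supportedZ z f : supported H f -> supported H (z *: f).
Proof. by move=> Hf s Hs; rewrite l1gZE Hf// mulr0. Qed.

Lemma supportedM f g : supported H f -> supported H g -> supported H (f * g).
Proof.
move=> Hf Hg s Hs; rewrite l1gME csum0// => t.
have [Ht|Ht] := pselect (H t); last by rewrite Hf ?mul0r.
rewrite Hg ?mulr0// => Hst; apply: Hs.
by rewrite -(subrK t s); exact: HD.
Qed.

Lemma supported_bsum (I : choiceType) (b : I -> A) :
  nsummable b -> (forall i, supported H (b i)) -> supported H (bsum b).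
Proof. by move=> sb Hb s Hs; rewrite bsumE// csum0// => i; exact: Hb. Qed.

Lemma supported_expl x : supported H x -> supported H (expl x).
Proof.
move=> Hx; rewrite expl_bsum; apply: supported_bsum; first exact: nsummable_exp.
move=> k; apply: supportedZ; elim: k => [|k IH].
  by rewrite expr0; exact: supported1.
by rewrite exprS; exact: supportedM.
Qed.

End Supported.

Fact delta_subproof (h : G) : (fun s : G => (s == h)%:R : C) \in @l1g_pred R G.
Proof.
rewrite unfold_in; apply: (@abs_summable_finsupp _ _ _ [fset h]%fset) => s.
by rewrite inE => /negbTE ->.
Qed.

Definition delta h : A := L1g (delta_subproof h).

Lemma deltaE h s : delta h s = (s == h)%:R. Proof. by []. Qed.

Lemma mulr_deltaE f h s : (f * delta h) s = f (s - h).
Proof.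
rewrite mulrC l1gME (@csum_single _ _ _ h) /= ?eqxx ?mul1r//.
by move=> t /negbTE ->; rewrite mul0r.
Qed.

Lemma nrm_delta h : nrm (delta h) = 1.
Proof.
apply: EFin_inj; rewrite -nrmE /asum (@esum_single _ _ _ h).
- by rewrite /= eqxx /cabs Normc.normc1.
- by move=> i; rewrite lee_fin cabs_ge0.
- by move=> i /= /negbTE ->; rewrite cabs0.
Qed.

(** A cosine: its Gelfand transform sends a character to the real part of its value at h. *)
Definition cosl h : A := (1 / 2 : R)%:C *: (delta h + delta (- h)).

Lemma coslE f h s :
  (f * cosl h) s = (1 / 2 : R)%:C * (f (s - h) + f (s + h)).
Proof.
by rewrite /cosl -scalerAr l1gZE mulrDr l1gDE !mulr_deltaE opprK.
Qed.

Lemma star_delta h : star (delta h) = delta (- h).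
Proof.
by apply: l1g_ext => s; rewrite starE !deltaE rmorph_nat eqr_oppLR.
Qed.

Lemma star_cosl h : star (cosl h) = cosl h.
Proof. by rewrite /cosl starZ conjc_real starD !star_delta opprK addrC. Qed.

Lemma nrm_cosl h : nrm (cosl h) <= 1.
Proof.
rewrite (le_trans (nrmZ _ _))// cabsR ger0_norm; last by lra.
have := nrmD (delta h) (delta (- h)); rewrite !nrm_delta; lra.
Qed.

Lemma supported_cosl (H : set G) h : H h -> H (- h) -> supported H (cosl h).
Proof.
move=> Hh HNh s Hs; rewrite /cosl l1gZE l1gDE !deltaE.
rewrite (_ : (s == h) = false); last by apply/eqP => sh; case: Hs; rewrite sh.
rewrite (_ : (s == - h) = false); last by apply/eqP => sh; case: Hs; rewrite sh.
by rewrite addr0 mulr0.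
Qed.

End Involution.

(** * Unitaries with small coefficients *)

Section Contraction.
Variables (R : realType) (G : zmodType).
Local Notation C := R[i].
Local Notation A := (l1g R G).
Implicit Types (f g x y : A).

(** Young's inequality: convolution by an l1 function is bounded for the sup norm. *)
Lemma mulr_le_sup f g (M : R) s :
  (forall t, cabs (f t) <= M) -> cabs ((f * g) s) <= M * nrm g.
Proof.
move=> fM; have M0 : 0 <= M := le_trans (cabs_ge0 _) (fM 0).
rewrite mulrC l1gME -lee_fin.
apply: (le_trans (csum_leE (abs_summable_conv_at g f s))).
apply: (@le_trans _ _ (asum (fun t => M%:C * g t))).
  apply: le_asum => t; rewrite !cabsM mulrC ler_wpM2r ?cabs_ge0//.
  by rewrite cabsR ger0_norm.
by apply: (le_trans (asumZ _ _)); rewrite nrmE cabsR ger0_norm// -EFinM.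
Qed.

Lemma cabsi : cabs 'i%C = 1 :> R.
Proof. by rewrite /cabs /= expr0n expr1n add0r sqrtr1. Qed.

Lemma l1g_small_off f (e : R) : 0 < e ->
  exists F : {fset G}, forall s, s \notin F -> cabs (f s) <= e.
Proof.
move=> e0; have [F HF] := asum_tail (l1gP f) e0; exists F => s sF.
rewrite -lee_fin ltW// (le_lt_trans _ HF)//.
have := cabs_le_asum (fun i => if i \in F then 0 else f i) s.
by rewrite (negbTE sF).
Qed.

(* Expand the exponential to second order: when f is small off F and h, 2h    *)
(* are not differences of elements of F, at most one of f(s), f(s - h),       *)
(* f(s + h) is large. If 2h = 0 the two shifts coincide, and the second-order *)
(* terms shrink f(s) even more.                                               *)
Lemma expl_cosl_contraction f (M lam : R) :
  0 < M -> (forall s, cabs (f s) <= M) -> `|lam| <= 1 / 2 ->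
  exists S : {fset G}, forall h, h \notin S -> h + h = 0 \/ h + h \notin S ->
    forall s, cabs ((f * expl ('i%C *: (lam%:C *: cosl R h))) s)
      <= (1 - lam ^+ 2 / 20) * M.
Proof.
move=> M0 fM l2; have [l0|l0] := eqVneq lam 0.
  exists fset0 => h _ _ s; rewrite l0 scale0r scaler0 expl0 mulr1.
  by rewrite expr0n mul0r subr0 mul1r.
pose l := `|lam|; have ll : 0 < l by rewrite normr_gt0.
have lE : lam ^+ 2 = l ^+ 2 by rewrite real_normK// num_real.
(* In the tightest case the second-order term gains l^2 M / 4, the cubic remainder costs at most l^2
   M / 6 because l <= 1/2, and 2 eta costs l^2 M / 50; more than l^2 M / 20 is left. *)
pose eta := l ^+ 2 * M / 100.
have e0 : 0 < eta by rewrite divr_gt0// mulr_gt0// exprn_gt0.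
have [F HF] := l1g_small_off f e0.
exists [fset a - b | a in F, b in F]%fset => h hS hhS s.
have sepF u a b : u \notin [fset a - b | a in F, b in F]%fset ->
    a - b = u -> cabs (f a) <= eta \/ cabs (f b) <= eta.
  move=> uS E; have [aF|aF] := boolP (a \in F); last by left; exact: HF.
  have [bF|bF] := boolP (b \in F); last by right; exact: HF.
  by move: uS => /negP[]; rewrite -E; apply/imfset2P; exists a => //; exists b.
set x := 'i%C *: _.
have xl : nrm x <= l.
  rewrite (le_trans (nrmZ _ _))// cabsi mul1r (le_trans (nrmZ _ _))// cabsR -/l.
  by rewrite ler_piMr ?nrm_cosl// ltW.
set T := expl x - (1 + x + (1 / 2 : R)%:C *: x ^+ 2).
have Tl : nrm T <= l ^+ 3 / 3.
  apply: (le_trans (nrm_exp_tail (le_trans xl l2))).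
  by rewrite ler_wpM2r// lerXn2r// nnegrE ?nrm_ge0// ltW.
have -> : expl x = (1 + x + (1 / 2 : R)%:C *: x ^+ 2) + T.
  by rewrite /T addrC subrK.
rewrite (mulrDr f (1 + x + _) T) l1gDE.
have fT : cabs ((f * T) s) <= M * (l ^+ 3 / 3).
  by rewrite (le_trans (mulr_le_sup _ _ fM))// ler_wpM2l// ltW.
have xE (g : A) t : (g * x) t =
    ('i%C * lam%:C) * ((1 / 2 : R)%:C * (g (t - h) + g (t + h))).
  by rewrite /x scalerA -scalerAr l1gZE coslE.
have PE : (f * (1 + x + (1 / 2 : R)%:C *: x ^+ 2)) s =
    f s + ('i%C * (lam / 2)%:C) * (f (s - h) + f (s + h)) +
    (- (lam ^+ 2 / 8)%:C) * ((f (s - h - h) + f s) + (f s + f (s + h + h))).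
  have x2E : (f * x ^+ 2) s = ('i%C * lam%:C) * ((1 / 2 : R)%:C *
      (('i%C * lam%:C) * ((1 / 2 : R)%:C * (f (s - h - h) + f s)) +
       ('i%C * lam%:C) * ((1 / 2 : R)%:C * (f s + f (s + h + h))))).
    by rewrite expr2 (mulrA f x x) (xE (f * x)) (xE f (s - h)) (xE f (s + h)) subrK addrK.
  rewrite (mulrDr f) (mulrDr f) mulr1 2!l1gDE (xE f s) -scalerAr l1gZE x2E.
  have -> : (lam / 2)%:C = lam%:C * (1 / 2 : R)%:C :> C.
    by rewrite -rmorphM mul1r.
  have -> : (lam ^+ 2 / 8)%:C = lam%:C ^+ 2 * (1 / 2 : R)%:C ^+ 3 :> C.
    by rewrite -!rmorphXn -rmorphM; congr (_%:C); field.
  have ii : 'i%C * 'i%C = - 1 :> C by rewrite -expr2 sqr_i.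
  set w := (1 / 2)%:C; set L := lam%:C.
  set X := f (s - h - h) + f s; set Y := f s + f (s + h + h).
  set Z := f (s - h) + f (s + h).
  transitivity (f s + 'i%C * (L * w) * Z + ('i%C * 'i%C) * (L ^+ 2 * w ^+ 3 * (X + Y))).
    by ring.
  by rewrite ii mulN1r mulNr.
move: PE; set P := f * _ => PE; clearbody P.
have l32 : l ^+ 3 * M <= l ^+ 2 * M / 2.
  have -> : l ^+ 3 * M = (l ^+ 2 * M) * l by rewrite exprSr mulrAC.
  apply: ler_wpM2l; last by rewrite -div1r.
  by rewrite mulr_ge0 ?exprn_ge0// ltW.
have l24 : l ^+ 2 * M <= M / 4.
  have : l ^+ 2 <= (1 / 2) ^+ 2 by rewrite lerXn2r// nnegrE ltW.
  by move=> h4; rewrite mulrC; apply: ler_wpM2l; [rewrite ltW|lra].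
rewrite (le_trans (cabsD _ _))//.
set p := cabs (P s); set q := cabs _ in fT *.
(* Left: f(s) may be large, but its shifts are at most eta. Right: f(s) is at most eta, the
   first-order shifts give at most M / 2 and the second-order ones l^2 M / 4, up to multiples of
   eta. *)
suff fin2 : p <= M - l ^+ 2 * M / 4 + 2 * eta \/ p <= M / 2 + l ^+ 2 * M / 4 + 2 * eta.
  rewrite lE mulrDl mul1r mulNr.
  rewrite /eta in fin2.
  have -> : l ^+ 2 / 20 * M = l ^+ 2 * M / 20 by rewrite mulrAC.
  have fT' : q <= l ^+ 3 * M / 3 by rewrite (le_trans fT)// mulrC mulrAC.
  have Q0 : 0 <= l ^+ 2 * M by rewrite mulr_ge0 ?exprn_ge0// ltW.
  move: fin2 l32 l24 fT' Q0; move: (l ^+ 2 * M) (l ^+ 3 * M) => Q Q3.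
  by case; lra.
have cabs1 (u : C) : cabs ('i%C * (lam / 2)%:C * u) = l / 2 * cabs u.
  rewrite !cabsM cabsi mul1r cabsR normrM -/l; congr (_ * _ * _).
  by rewrite ger0_norm// invr_ge0 ler0n.
have cabs2 (u : C) : cabs (- (lam ^+ 2 / 8)%:C * u) = l ^+ 2 / 8 * cabs u.
  rewrite cabsM cabsN cabsR lE ger0_norm// divr_ge0// exprn_ge0// ltW//.
have l20 : 0 <= l ^+ 2 by rewrite exprn_ge0// ltW.
have l21 : l ^+ 2 <= 1 / 4.
  have : l ^+ 2 <= (1 / 2) ^+ 2 by rewrite lerXn2r// nnegrE ltW.
  lra.
have fs := fM s.
have Q0 : 0 <= l ^+ 2 * M by rewrite mulr_ge0// ltW.
have l2' : l <= 1 / 2 by [].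
have c0 (t : G) : 0 <= cabs (f t) by exact: cabs_ge0.
case: hhS => [hh0|hhS].
  have hN : s - h = s + h by rewrite -[LHS]addr0 -hh0 addrA subrK.
  have sh : s + h + h = s by rewrite -addrA hh0 addr0.
  have {}PE : p <= (1 - l ^+ 2 / 2) * cabs (f s) + l * cabs (f (s + h)).
    rewrite /p PE hN addrK sh.
    rewrite (_ : _ + _ + _ = (1 - l ^+ 2 / 2)%:C * f s + 'i%C * (lam / 2)%:C *
      (f (s + h) + f (s + h))); last first.
      rewrite -lE.
      have -> : (1 - lam ^+ 2 / 2)%:C = 1 - 4 * (lam ^+ 2 / 8)%:C :> C.
        rewrite rmorphB rmorph1; congr (_ - _).
        have -> : 4 = 4%:C :> C by rewrite rmorph_nat.
        by rewrite -rmorphM; congr (_%:C); field.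
      by ring.
    rewrite (le_trans (cabsD _ _))// lerD//.
      rewrite cabsM cabsR ger0_norm//; lra.
    rewrite cabs1 (le_trans (ler_wpM2l _ (cabsD _ _)))//; lra.
  have [a1|b1] : cabs (f s) <= eta \/ cabs (f (s + h)) <= eta.
    by apply/or_comm/(sepF _ _ _ hS); rewrite addrC addKr.
  - right.
    have h1 : (1 - l ^+ 2 / 2) * cabs (f s) <= 1 * eta.
      apply: ler_pM => //; lra.
    have h2 : l * cabs (f (s + h)) <= (1 / 2) * M by apply: ler_pM => //; lra.
    have h3 : p <= 1 * eta + 1 / 2 * M.
      by rewrite (le_trans PE)// lerD.
    lra.
  - left.
    have h1 : (1 - l ^+ 2 / 2) * cabs (f s) <= (1 - l ^+ 2 / 2) * M.
      by apply: ler_wpM2l => //; lra.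
    have h2 : l * cabs (f (s + h)) <= 1 * eta by apply: ler_pM => //; lra.
    have h3 : p <= M - l ^+ 2 * M / 2 + 1 * eta.
      have h4 : (1 - l ^+ 2 / 2) * M = M - l ^+ 2 * M / 2 by field.
      by rewrite -h4 (le_trans PE)// lerD.
    lra.
have {}PE : p <= (1 - l ^+ 2 / 4) * cabs (f s) +
    l / 2 * (cabs (f (s - h)) + cabs (f (s + h))) +
    l ^+ 2 / 8 * (cabs (f (s - h - h)) + cabs (f (s + h + h))).
  rewrite /p PE.
  rewrite (_ : _ + _ + _ = (1 - l ^+ 2 / 4)%:C * f s +
      'i%C * (lam / 2)%:C * (f (s - h) + f (s + h)) +
      - (lam ^+ 2 / 8)%:C * (f (s - h - h) + f (s + h + h))); last first.
    rewrite -lE.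
    have -> : (1 - lam ^+ 2 / 4)%:C = 1 - 2 * (lam ^+ 2 / 8)%:C :> C.
      rewrite rmorphB rmorph1; congr (_ - _).
      have -> : 2 = 2%:C :> C by rewrite rmorph_nat.
      by rewrite -rmorphM; congr (_%:C); field.
    by ring.
  rewrite (le_trans (cabsD _ _))// lerD//.
    rewrite (le_trans (cabsD _ _))// lerD//.
      by rewrite cabsM cabsR ger0_norm//; lra.
    by rewrite cabs1 ler_wpM2l ?cabsD//; lra.
  by rewrite cabs2 ler_wpM2l ?cabsD//; lra.
have [a1|a1] := lerP (cabs (f s)) eta.
- right.
  have h1 : (1 - l ^+ 2 / 4) * cabs (f s) <= 1 * eta by apply: ler_pM => //; lra.
  have h2 : l / 2 * (cabs (f (s - h)) + cabs (f (s + h))) <= 1 / 4 * (M + eta).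
    apply: ler_pM; [lra|exact: addr_ge0|lra|].
    have [b1|b2] : cabs (f (s + h)) <= eta \/ cabs (f (s - h)) <= eta.
      by apply: (sepF _ _ _ hhS); rewrite opprB addrA addrAC (addrC s) addrK.
    + exact: lerD.
    + by rewrite addrC lerD.
  have h3 : l ^+ 2 / 8 * (cabs (f (s - h - h)) + cabs (f (s + h + h))) <=
      l ^+ 2 / 8 * (M + M).
    by apply: ler_wpM2l; [lra|exact: lerD].
  have h4 : l ^+ 2 / 8 * (M + M) = l ^+ 2 * M / 4 by field.
  lra.
- left.
  have far u t : u \notin [fset a - b | a in F, b in F]%fset ->
      s - t = u \/ t - s = u -> cabs (f t) <= eta.
    by move=> uS [] /(sepF _ _ _ uS) []//; rewrite leNgt a1.
  have b1 : cabs (f (s - h)) <= eta by apply: (far h) => //; left; rewrite subKr.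
  have b2 : cabs (f (s + h)) <= eta by apply: (far h) => //; right; rewrite addrAC subrr add0r.
  have c1 : cabs (f (s - h - h)) <= eta.
    by apply: (far (h + h)) => //; left; rewrite -addrA -opprD subKr.
  have c2 : cabs (f (s + h + h)) <= eta.
    by apply: (far (h + h)) => //; right; rewrite -(addrA s) addrAC subrr add0r.
  have h1 : (1 - l ^+ 2 / 4) * cabs (f s) <= (1 - l ^+ 2 / 4) * M.
    by apply: ler_wpM2l => //; lra.
  have h2 : l / 2 * (cabs (f (s - h)) + cabs (f (s + h))) <= 1 / 4 * (eta + eta).
    by apply: ler_pM; [lra|exact: addr_ge0|lra|exact: lerD].
  have h3 : l ^+ 2 / 8 * (cabs (f (s - h - h)) + cabs (f (s + h + h))) <=
      1 / 8 * (eta + eta).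
    by apply: ler_pM; [lra|exact: addr_ge0|lra|exact: lerD].
  have h4 : (1 - l ^+ 2 / 4) * M = M - l ^+ 2 * M / 4 by field.
  lra.
Qed.

End Contraction.

(* Use elements of order 2 if there are infinitely many of them; otherwise    *)
(* doubling has finite fibres.                                                *)
Lemma infinite_avoid_double (G : zmodType) (H : set G) (S : {fset G}) :
  (forall s t, H s -> H t -> H (s + t)) -> (forall s, H s -> H (- s)) ->
  infinite_set H ->
  exists h, [/\ H h, h \notin S & h + h = 0 \/ h + h \notin S].
Proof.
move=> HD HN infH; pose H2 := H `&` [set h | h + h = 0].
have [infH2|/contrapT finH2] := pselect (infinite_set H2).
  have [h [[Hh hh0] hS]] := infinite_setN0 (infinite_setD infH2 (finite_fset S)).
  by exists h; split => //; [exact/negP|left].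
pose B := [set` S] `|` \bigcup_(s in [set` S]) (H `&` [set h | h + h = s]).
have finB : finite_set B.
  rewrite finite_setU; split; first exact: finite_fset.
  apply: bigcup_finite; first exact: finite_fset.
  (* Two solutions in H of h + h = s differ by an element of [H2]. *)
  move=> s _; have [[k [Hk ks]]|nk] := pselect (exists k, H k /\ k + k = s).
    apply: (@sub_finite_set _ _ ((fun t => k + t) @` H2)); last exact: finite_image.
    move=> h [Hh /= hs]; exists (h - k); last by rewrite addrC subrK.
    split; first by apply: HD => //; exact: HN.
    by rewrite /= addrACA -opprD hs ks subrr.
  by apply: (@sub_finite_set _ _ set0) => // h [Hh hs]; case: nk; exists h.
have [h [Hh hB]] := infinite_setN0 (infinite_setD infH finB).
have hS : h \notin S by apply/negP => hS; apply: hB; left.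
exists h; split => //; right; apply/negP => hhS; apply: hB; right.
by exists (h + h).
Qed.

(** Dependent choice, where each term may depend on the whole list of its predecessors. *)
Lemma prefix_choice (T : Type) (x0 : T) (Q : seq T -> T -> Prop) :
  (forall l, exists x, Q l x) -> exists h : nat -> T, forall n, Q (mkseq h n) (h n).
Proof.
move=> /choice [f Qf]; pose hs n := iter n (fun l => rcons l (f l)) [::].
exists (fun n => f (hs n)) => n.
suff -> : mkseq (fun n => f (hs n)) n = hs n by exact: Qf.
by elim: n => [//|n IH]; rewrite mkseqS IH.
Qed.

(** * Choice of the frequencies and decay of the coefficients *)

Section UnitaryFamily.
Variables (R : realType) (G : zmodType) (H : set G).
Hypotheses (H0 : H 0) (HD : forall s t, H s -> H t -> H (s + t)).
Hypotheses (HN : forall s, H s -> H (- s)) (infH : infinite_set H).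
Local Notation C := R[i].
Local Notation A := (l1g R G).
Local Notation Z2 := (int * int)%type.

Definition maxnorm (w : Z2) : nat := maxn `|w.1|%N `|w.2|%N.

Variable K : nat.
Hypothesis K0 : (0 < K)%N.

(* Summable over k, yet for each N >= 1 there are about K * sqrt N values of  *)
(* k with N * freq k in the interval [1/32, 1/2].                             *)
Definition freq (k : nat) : R := (K%:R / (k + K)%:R) ^+ 2 / 2.

(* The even indices n build f1, the odd ones f2.                              *)
Definition phase (n : nat) (w : Z2) : R :=
  freq n./2 * (if odd n then w.2 else w.1)%:~R.

(* Bounds the sup norm of the product of the first n factors of F_w: the nth  *)
(* factor is a contraction once its phase is at most 1/2, and the trivial     *)
(* bound 1 is used until then.                                                *)
Fixpoint decay (n : nat) (w : Z2) : R :=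
  if n is n'.+1 then
    if (maxnorm w)%:R * freq n'./2 <= 1 / 2
    then (1 - phase n' w ^+ 2 / 20) * decay n' w else 1
  else 1.

Lemma freq_gt0 k : 0 < freq k.
Proof. by rewrite divr_gt0// exprn_gt0// divr_gt0// ltr0n// addn_gt0 K0 orbT. Qed.

Lemma phase_le n w : `|phase n w| <= (maxnorm w)%:R * freq n./2.
Proof.
rewrite normrM (gtr0_norm (freq_gt0 _)) mulrC.
apply: ler_wpM2r; first by rewrite ltW// freq_gt0.
rewrite -intr_norm -abszE -pmulrn ler_nat /maxnorm.
by case: odd; rewrite leq_max leqnn ?orbT.
Qed.

Lemma contraction_factor (t : R) : `|t| <= 1 / 2 -> 0 < 1 - t ^+ 2 / 20 <= 1.
Proof.
move=> t2; have : t ^+ 2 <= (1 / 2) ^+ 2.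
  by rewrite -(real_normK (num_real t)) lerXn2r// nnegrE.
have := sqr_ge0 t; lra.
Qed.

Lemma decay_gt0 n w : 0 < decay n w.
Proof.
elim: n => [//|n IH] /=; case: ifP => // le2; rewrite mulr_gt0//.
by case/andP: (contraction_factor (le_trans (phase_le n w) le2)).
Qed.

Lemma decay_le1 n w : decay n w <= 1.
Proof.
elim: n => [//|n IH] /=; case: ifP => // le2.
have /andP[c0 c1] := contraction_factor (le_trans (phase_le n w) le2).
by rewrite mulr_ile1// ltW// decay_gt0.
Qed.

Definition phase_sum (h : nat -> G) (n : nat) (w : Z2) : A :=
  \sum_(k < n) (phase k w)%:C *: cosl R (h k).

Lemma star_phase_term h k w :
  star ((phase k w)%:C *: cosl R h) = (phase k w)%:C *: cosl R h :> A.
Proof. by rewrite starZ conjc_real star_cosl. Qed.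

Lemma star_phase_sum h n w : star (phase_sum h n w) = phase_sum h n w.
Proof.
rewrite /phase_sum; elim/big_rec : _ => [|i x _ IH].
  by rewrite -(subrr (1 : A)) starB !subrr.
by rewrite starD IH star_phase_term.
Qed.

Lemma finite_maxnorm (N : nat) : exists W : seq Z2, forall w, (maxnorm w <= N)%N -> w \in W.
Proof.
pose r := [seq (i%:Z - N%:Z)%R | i <- iota 0 (N + N).+1].
have rP z : (`|z| <= N)%N -> z \in r.
  move=> zN; apply/mapP; exists (absz (z + N%:Z)); last by lia.
  by rewrite mem_iota; lia.
exists [seq (u, v) | u <- r, v <- r] => -[u v]; rewrite /maxnorm geq_max /= => /andP[uN vN].
exact: (allpairs_f pair (rP _ uN) (rP _ vN)).
Qed.

Lemma common_avoid (W : seq Z2) (P : Z2 -> {fset G} -> Prop) :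
  (forall w S S', (S `<=` S')%fset -> P w S -> P w S') ->
  (forall w, exists S, P w S) -> exists S, forall w, w \in W -> P w S.
Proof.
move=> mono ex; elim: W => [|w W [S IH]]; first by exists fset0.
have [S' wS'] := ex w; exists (S `|` S')%fset => w'; rewrite inE => /predU1P[->|/IH].
  by apply: mono wS'; exact: fsubsetUr.
by apply: mono; exact: fsubsetUl.
Qed.

(** At stage n only finitely many w meet the phase condition in [decay], so the finite sets which
    [expl_cosl_contraction] asks the next frequency to avoid have a finite union, and the infinite
    group H escapes it. For every other w the bound is 1, by unitarity. *)
Lemma exists_frequencies : exists h : nat -> G, (forall n, H (h n)) /\
  forall n w s, cabs (expl ('i%C *: phase_sum h n w) s) <= decay n w.
Proof.
(* The choice ranges over arbitrary lists, so the bound on the previous product is a premise of [Q];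
   the induction on n supplies it afterwards. *)
pose Q (l : seq G) (g : G) := H g /\ forall w,
  (maxnorm w)%:R * freq (size l)./2 <= 1 / 2 ->
  let f := expl ('i%C *: phase_sum (nth 0 l) (size l) w) in
  (forall s, cabs (f s) <= decay (size l) w) ->
  forall s, cabs ((f * expl ('i%C *: ((phase (size l) w)%:C *: cosl R g))) s) <=
    (1 - phase (size l) w ^+ 2 / 20) * decay (size l) w.
have [l|h hQ] := @prefix_choice G 0 Q.
  set n := size l.
  have [W WP] := finite_maxnorm (Num.truncn (1 / 2 / freq n./2)).
  pose P w (S : {fset G}) := forall g, g \notin S -> g + g = 0 \/ g + g \notin S ->
    (maxnorm w)%:R * freq n./2 <= 1 / 2 ->
    let f := expl ('i%C *: phase_sum (nth 0 l) n w) in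
    (forall s, cabs (f s) <= decay n w) ->
    forall s, cabs ((f * expl ('i%C *: ((phase n w)%:C *: cosl R g))) s) <=
      (1 - phase n w ^+ 2 / 20) * decay n w.
  have [w S S' /fsubsetP SS' PS g gS ggS|w|S WS] := @common_avoid W P.
  - apply: PS; first by apply: contra gS => /SS'.
    by case: ggS => [|ggS]; [left|right; apply: contra ggS => /SS'].
  - pose f := expl ('i%C *: phase_sum (nth 0 l) n w).
    have [cond|ncond] := pselect ((maxnorm w)%:R * freq n./2 <= 1 / 2 /\
      forall s, cabs (f s) <= decay n w).
      case: cond => c1 c2.
      have [S HS] := expl_cosl_contraction (decay_gt0 n w) c2
        (le_trans (phase_le n w) c1).
      by exists S => g gS ggS _ f' _; exact: HS.
    by exists fset0 => g _ _ c1 f' c2; case: ncond.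
  have [g [Hg gS ggS]] := infinite_avoid_double S HD HN infH.
  exists g; split => // w wn f fM s; apply: WS => //.
  apply: WP; rewrite truncn_ge_nat.
    by rewrite ler_pdivlMr ?freq_gt0.
  by rewrite divr_ge0// ltW// freq_gt0.
exists h; split => [n|]; first by case: (hQ n).
elim=> [|n IH] w s /=.
  by rewrite unitary_bound// star_phase_sum.
case: ifPn => [le2|_]; last by rewrite unitary_bound// star_phase_sum.
have [_ /(_ w)] := hQ n; rewrite size_mkseq /=.
have -> : phase_sum (nth 0 (mkseq h n)) n w = phase_sum h n w.
  by apply: eq_bigr => k _; rewrite nth_mkseq.
move=> Hw; have := Hw le2 (IH w) s.
by rewrite /phase_sum big_ord_recr /= scalerDr explD.
Qed.

(** Here s plays the role of sqrt(N) rounded up, and K / (k + K) <= 1 / s. *)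
Lemma le1_maxnorm_freq N s k : (0 < s)%N -> (N <= s ^ 2)%N -> (K * s <= k + K)%N ->
  N%:R * freq k <= 1 / 2.
Proof.
move=> s0 Ns Ks; rewrite /freq mulrA ler_wpM2r// expr_div_n mulrA.
have kK : (0 < k + K)%N by rewrite addn_gt0 K0 orbT.
rewrite ler_pdivrMr ?exprn_gt0 ?ltr0n// mul1r -!natrX -natrM ler_nat.
by apply: leq_trans (_ : (K * s) ^ 2 <= _)%N; rewrite ?leq_sqr// expnMn mulnC leq_mul2l Ns orbT.
Qed.

(** N >= s^2 / 4 and (K / (k + K))^2 >= 1 / (4 s^2), and [freq] carries a further factor 1/2: this
    is the 1/32. *)
Lemma maxnorm_freq_ge N s k : (s ^ 2 <= 4 * N)%N -> (k + K <= 2 * (K * s))%N ->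
  1 / 32 <= N%:R * freq k.
Proof.
move=> sN Ks; rewrite /freq mulrA expr_div_n.
have kK : (0 < k + K)%N by rewrite addn_gt0 K0 orbT.
rewrite ler_pdivlMr// mulrA ler_pdivlMr ?exprn_gt0 ?ltr0n//.
suff : (k + K)%:R ^+ 2 <= 16 * (N%:R * K%:R ^+ 2) :> R by lra.
rewrite -!natrX -natrM -natrM ler_nat.
apply: leq_trans (_ : (2 * (K * s)) ^ 2 <= _)%N; first by rewrite leq_sqr.
nia.
Qed.

Lemma decayS_le n w : (maxnorm w)%:R * freq n./2 <= 1 / 2 ->
  decay n.+1 w <= decay n w.
Proof.
move=> le2; rewrite /= le2.
have /andP[_ c1] := contraction_factor (le_trans (phase_le n w) le2).
by rewrite ler_piMl// ltW// decay_gt0.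
Qed.

Local Notation q := (1 - (1 / 32) ^+ 2 / 20 : R).

(** The steps 2k and 2k + 1 share the weight [freq k] and test the two coordinates of w. The larger
    coordinate yields the factor q, and the other step does not increase the bound. *)
Lemma decay2_le k w : (maxnorm w)%:R * freq k <= 1 / 2 ->
  1 / 32 <= (maxnorm w)%:R * freq k -> decay k.*2.+2 w <= q * decay k.*2 w.
Proof.
move=> le2 ge32.
have half1 : k.*2.+1./2 = k by rewrite /= uphalf_double.
have half0 : k.*2./2 = k by rewrite doubleK.
have main n : n./2 = k -> `|(if odd n then w.2 else w.1)|%N = maxnorm w ->
    decay n.+1 w <= q * decay n w.
  move=> nk wn; rewrite /= nk le2; apply: ler_wpM2r; first by rewrite ltW// decay_gt0.
  have -> : phase n w ^+ 2 = ((maxnorm w)%:R * freq k) ^+ 2.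
    rewrite -[LHS](real_normK (num_real _)) normrM nk (gtr0_norm (freq_gt0 _)).
    by rewrite -intr_norm -abszE -pmulrn wn mulrC.
  have : (1 / 32) ^+ 2 <= ((maxnorm w)%:R * freq k) ^+ 2.
    rewrite lerXn2r// nnegrE//; last lra.
  lra.
have q0 : 0 <= q by lra.
have [uv|uv] := leqP `|w.1|%N `|w.2|%N.
  rewrite (le_trans (main k.*2.+1 _ _))//.
    by rewrite /= odd_double /= /maxnorm (maxn_idPr uv).
  by rewrite ler_wpM2l// decayS_le// half0.
rewrite (le_trans (decayS_le _))//; first by rewrite half1.
by rewrite main// odd_double /maxnorm (maxn_idPl (ltnW uv)).
Qed.

Lemma ceil_sqrt N : (0 < N)%N ->
  exists s, [/\ (0 < s)%N, (N <= s ^ 2)%N & (s ^ 2 <= 4 * N)%N].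
Proof.
move=> N0; have ex : exists s, (N <= s ^ 2)%N by exists N; nia.
case: (ex_minnP ex) => s Ns smin; exists s.
case: s => [|[|s]] in Ns smin *; first by lia.
  by split => //; lia.
have lt : (s.+1 ^ 2 < N)%N by rewrite ltnNge; apply/negP => /smin; rewrite ltnn.
by split => //; nia.
Qed.

(** The window K s <= k + K < 2 K s holds K s indices k, each worth a factor q by [decay2_le]; past
    the window the bound never increases. *)
Lemma decay_eventually w : (0 < maxnorm w)%N -> exists s n0,
  (maxnorm w <= s ^ 2)%N /\ forall n, (n0 <= n)%N -> decay n w <= q ^+ (K * s).
Proof.
move=> N0; have [s [s0 Ns sN]] := ceil_sqrt N0.
exists s, (2 * (K * s) - K).*2%N; split => // n.
have KKs : (K <= K * s)%N by rewrite leq_pmulr.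
have H1 j : (j <= K * s)%N -> decay (K * s - K + j).*2 w <= q ^+ j.
  elim: j => [|j IH] jK; first by rewrite expr0 decay_le1.
  rewrite addnS doubleS exprS.
  apply: (le_trans (decay2_le _ _)).
  - by apply: (le1_maxnorm_freq s0 Ns); lia.
  - by apply: (maxnorm_freq_ge sN); lia.
  - by apply: ler_wpM2l; [lra|apply: IH; lia].
elim: n => [|n IH] n0n.
  have := H1 (K * s)%N (leqnn _); congr (decay _ _ <= _); lia.
move: n0n; rewrite leq_eqVlt => /predU1P[<-|n0n].
  have := H1 (K * s)%N (leqnn _); congr (decay _ _ <= _); lia.
apply: le_trans (IH n0n); apply: decayS_le.
by apply: (le1_maxnorm_freq s0 Ns); lia.
Qed.

End UnitaryFamily.

(** * Commuting unitaries indexed by Z^2 *)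

Section Exponentials.
Variables (R : realType) (G : zmodType) (H : set G).
Hypotheses (H0 : H 0) (HD : forall s t, H s -> H t -> H (s + t)).
Hypotheses (HN : forall s, H s -> H (- s)) (infH : infinite_set H).
Local Notation C := R[i].
Local Notation A := (l1g R G).
Local Notation Z2 := (int * int)%type.

(** Telescoping, from 1 / (x + 1)^2 <= 1 / x - 1 / (x + 1). *)
Lemma esum_inv_sqr_le :
  (\esum_(k in [set: nat]) ((k.+1%:R : R) ^- 2)%:E <= 2%:E)%E.
Proof.
apply: esum_nat_le => [k|n]; first by rewrite invr_ge0 exprn_ge0// ler0n.
have step m : \sum_(k < m.+1) (k.+1%:R : R) ^- 2 <= 2 - m.+1%:R^-1.
  elim: m => [|m IH].
    by rewrite big_ord_recr big_ord0 /= expr1n invr1; lra.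
  rewrite big_ord_recr /=; set S := \sum_(i < _) _.
  have {}IH : S <= 2 - m.+1%:R^-1 by [].
  have : (m.+2%:R : R) ^- 2 <= m.+1%:R^-1 - m.+2%:R^-1.
    rewrite -[m.+2%:R]natr1; move: (m.+1%:R : R) (ltr0Sn R m) => x x0.
    have x1 : 0 < x + 1 by rewrite addr_gt0.
    have -> : x^-1 - (x + 1)^-1 = (x * (x + 1))^-1 by field; rewrite !gt_eqF.
    rewrite lef_pV2 ?posrE ?mulr_gt0 ?exprn_gt0// expr2.
    by apply: ler_wpM2r; lra.
  by move=> le2; apply: (le_trans (lerD IH le2)); rewrite addrA subrK.
case: n => [|n]; first by rewrite big_ord0.
by rewrite (le_trans (step n))// gerBl invr_ge0 ler0n.
Qed.

Lemma nsummable_phase K (h : nat -> G) (w : Z2) : (0 < K)%N ->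
  nsummable (fun k => (phase R K k w)%:C *: cosl R (h k) : A).
Proof.
move=> K0; apply: nsummableP.
(* As K >= 1, k + 1 <= 2 (k./2 + K), hence [freq K k./2] is at most 2 K^2 / (k + 1)^2. *)
pose c : R := (maxnorm w)%:R * (2 * K%:R ^+ 2).
have c0 : 0 <= c by rewrite mulr_ge0 ?mulr_ge0 ?exprn_ge0 ?ler0n.
apply: (@le_lt_trans _ _
  (\esum_(k in [set: nat]) (c%:E * ((k.+1%:R : R) ^- 2)%:E))%E).
  apply: le_esum => k _; rewrite -EFinM lee_fin.
  rewrite (le_trans (nrmZ _ _))// cabsR.
  apply: (@le_trans _ _ (`|phase R K k w|)).
    by rewrite ler_piMr ?nrm_cosl.
  rewrite (le_trans (phase_le R K0 k w))// /c -mulrA ler_wpM2l ?ler0n//.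
  rewrite /freq expr_div_n.
  have kK : (0 < k./2 + K)%N by rewrite addn_gt0 K0 orbT.
  have m0 : (0 : R) < (k./2 + K)%:R ^+ 2 by rewrite exprn_gt0// ltr0n.
  have kk : (k.+1%:R : R) ^+ 2 <= 4 * (k./2 + K)%:R ^+ 2.
    rewrite -!natrX -natrM ler_nat.
    have : (k.+1 <= 2 * (k./2 + K))%N by lia.
    by rewrite -leq_sqr expnMn.
  have k0 : (0 : R) < k.+1%:R ^+ 2 by rewrite exprn_gt0// ltr0n.
  have : ((k./2 + K)%:R ^+ 2)^-1 <= 4 / (k.+1%:R ^+ 2) :> R.
    by rewrite ler_pdivlMr// mulrC ler_pdivrMr.
  have : (0 : R) <= K%:R ^+ 2 by rewrite exprn_ge0// ler0n.
  move: (K%:R ^+ 2 : R) ((_ ^+ 2)^-1 : R) ((k.+1%:R ^+ 2)^-1 : R) => a u v.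
  nra.
apply: le_lt_trans (esumZl_le c0 _) _.
  by move=> k; rewrite lee_fin invr_ge0 exprn_ge0// ler0n.
by rewrite lte_mul_pinfty// ?lee_fin// (le_lt_trans esum_inv_sqr_le)// ltry.
Qed.

Lemma bsumD (I : choiceType) (b c : I -> A) : nsummable b -> nsummable c ->
  bsum (fun i => b i + c i) = bsum b + bsum c.
Proof.
move=> sb sc; apply: l1g_ext => s; rewrite l1gDE !bsumE//.
  rewrite -csumD//; exact: nsummable_col.
exact: (abs_summableD sb sc).
Qed.

Lemma star_bsum (I : choiceType) (b : I -> A) : nsummable b ->
  (forall i, star (b i) = b i) -> star (bsum b) = bsum b.
Proof.
move=> sb bs; apply: l1g_ext => s; rewrite starE !bsumE// -csum_conj.
  by congr csum; apply/funext => i; rewrite -{2}(bs i) starE.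
exact: nsummable_col.
Qed.

(** F_w = exp(i X_w) with X additive in w and self-adjoint. For the decay, split X_w into a long
    partial sum, controlled by [decay], and a tail that costs at most a factor 2. If N is the size
    of w and N <= s^2, then q^(K s) <= 4^(- r s) <= (N + 1)^(- r). *)
Lemma exists_unitary_family (r : nat) : exists F : Z2 -> A,
  [/\ forall w w', F (w + w') = F w * F w', F 0 = 1,
      forall w, star (F w) = F (- w), forall w, supported H (F w) &
      forall w s, cabs (F w s) <= 2 / (maxnorm w).+1%:R ^+ r].
Proof.
pose q : R := 1 - (1 / 32) ^+ 2 / 20.
have q01 : 0 <= q < 1 by apply/andP; rewrite /q; split; lra.
have [q0 _] := andP q01.
have [K [K0 Kq]] : exists K, (0 < K)%N /\ q ^+ K <= (1 / 2) ^+ (2 * r).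
  have := @cvg_expr R q; rewrite ger0_norm; last by case/andP: q01.
  move=> /(_ (proj2 (andP q01))) /cvgrPdist_le /(_ ((1 / 2) ^+ (2 * r))).
  rewrite exprn_gt0//.
  move=> /(_ isT) [n _ Hn]; exists n.+1; split => //.
  have := Hn n.+1 (leqnSn n); rewrite /= sub0r normrN ger0_norm//.
  by rewrite exprn_ge0//; case/andP: q01.
have [h [Hh hP]] := exists_frequencies R HD HN infH K0.
pose b w k : A := (phase R K k w)%:C *: cosl R (h k).
have sb w : nsummable (b w) by exact: nsummable_phase.
have bD w w' k : b (w + w') k = b w k + b w' k.
  rewrite /b -scalerDl -rmorphD /phase -mulrDr -rmorphD.
  by congr (_%:C *: _); congr (_ * _%:~R); case: odd.
pose X w := bsum (b w).
have XD w w' : X (w + w') = X w + X w'.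
  by rewrite /X -bsumD//; congr bsum; apply/funext => k.
have X0 : X 0 = 0.
  by apply: (@addrI _ (X 0)); rewrite -XD !addr0.
have XN w : X (- w) = - X w.
  by apply: (@addrI _ (X w)); rewrite -XD !subrr.
have sX w : star (X w) = X w.
  by apply: star_bsum => // k; exact: star_phase_term.
exists (fun w => expl ('i%C *: X w)); split.
- by move=> w w'; rewrite XD scalerDr explD.
- by rewrite X0 scaler0 expl0.
- by move=> w; rewrite star_expl starZ sX conjci XN scaleNr scalerN.
- move=> w; apply: supported_expl => //; apply: supportedZ.
  apply: supported_bsum => // k; apply: supportedZ.
  by apply: supported_cosl; [exact: Hh|exact/HN/Hh].
move=> w s.
have [w0|] := posnP (maxnorm w).
  rewrite w0 expr1n invr1 mulr1 (le_trans (unitary_bound _ (sX w)))//; lra.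
move=> /(decay_eventually R K0) [s0 [n0 [Ns Hn]]].
have h2 : (0 : R) < 1 / 2 by lra.
(* A tail of norm at most 1/2 suffices; no limit of the sup norm bounds is taken. *)
have [n1 Hn1] := bsum_tail (sb w) h2.
pose n := maxn n0 n1.
have := Hn1 n (leq_maxr _ _); rewrite -/(X w); set T := X w - _ => T2.
have -> : X w = phase_sum R K h n w + T by rewrite addrC subrK.
rewrite scalerDr explD.
rewrite (le_trans (mulr_le_sup _ _ (hP n w)))//.
rewrite mulrC; apply: ler_pM.
- exact: nrm_ge0.
- by rewrite ltW// decay_gt0.
- apply: nrm_exp_le2; rewrite (le_trans (nrmZ _ _))// cabsi mul1r//.
rewrite (le_trans (Hn n (leq_maxl _ _)))// exprM.
apply: (@le_trans _ _ (((1 / 2) ^+ (2 * r)) ^+ s0)).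
  by apply: lerXn2r; rewrite ?nnegrE ?exprn_ge0.
rewrite -exprM mulnC mulnA exprM -exprVn.
apply: lerXn2r; rewrite ?nnegrE ?exprn_ge0 ?invr_ge0 ?ler0n//.
rewrite div1r exprVn lef_pV2 ?posrE ?exprn_gt0 ?ltr0n//.
rewrite -natrX ler_nat.
have : (s0 < 2 ^ s0)%N by exact: ltn_expl.
by rewrite expnM; nia.
Qed.

End Exponentials.

(** * Failure of spectral synthesis *)

Section Obstruction.
Variables (R : realType) (G : zmodType) (H : set G).
Hypotheses (H0 : H 0) (HD : forall s t, H s -> H t -> H (s + t)).
Hypotheses (HN : forall s, H s -> H (- s)) (infH : infinite_set H).
Local Notation C := R[i].
Local Notation A := (l1g R G).
Local Notation Z2 := (int * int)%type.

(** Dominated by the product of two one-variable series, since (max + 1)^4 >= (|u| + 1)^2 (|v| +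
    1)^2. *)
Lemma abs_summable_maxnorm : abs_summable (fun w : Z2 => ((maxnorm w).+1%:R ^- 4 : R)%:C).
Proof.
pose g (z : int) : R := (`|z|%N.+1%:R) ^- 2.
have g0 z : 0 <= g z by rewrite invr_ge0 exprn_ge0// ler0n.
have gfin : (\esum_(z in [set: int]) (g z)%:E < +oo)%E.
  pose e (p : bool * nat) : int := if p.1 then Posz p.2 else Negz p.2.
  rewrite (@reindex_esum R (bool * nat)%type int setT setT e); last first.
    split => // [[[] m] [[] n] _ _ //= [->]//|z _].
    by case: z => n; [exists (true, n)|exists (false, n)].
  apply: (@le_lt_trans _ _
    (\esum_(b in [set: bool]) \esum_(k in [set: nat]) ((k.+1%:R : R) ^- 2)%:E)%E).
    rewrite (@esum_esum R _ _ [set: bool] (fun=> [set: nat])); last first.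
      by move=> i j _ _; rewrite lee_fin invr_ge0 exprn_ge0// ler0n.
    rewrite (_ : _ `*`` _ = setT); last by apply/seteqP; split.
    apply: le_esum => -[b k] _; rewrite lee_fin /g /e /=.
    rewrite lef_pV2 ?posrE ?exprn_gt0 ?ltr0n// lerXn2r ?nnegrE ?ler0n// ler_nat.
    by case: b.
  apply: (@le_lt_trans _ _ (\esum_(b in [set: bool]) 2%:E)%E).
    by apply: le_esum => b _; exact: esum_inv_sqr_le.
  rewrite (@esum_finsupp _ _ _ [fset true; false]%fset) ?sumEFin ?ltry//.
  by move=> []; rewrite !inE.
pose sg := fine (\esum_(z in [set: int]) (g z)%:E).
have sgE : (\esum_(z in [set: int]) (g z)%:E)%E = sg%:E.
  by rewrite fineK// ge0_fin_numE// esum_ge0// => z _; rewrite lee_fin.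
have sg0 : 0 <= sg by rewrite -lee_fin -sgE esum_ge0// => z _; rewrite lee_fin.
rewrite /abs_summable asum_prod.
apply: (@le_lt_trans _ _ (\esum_(z in [set: int]) (sg%:E * (g z)%:E))%E).
  apply: le_esum => u _; rewrite muleC -sgE.
  apply: le_trans (esumZl_le (g0 u) _); last by move=> z; rewrite lee_fin.
  apply: le_esum => v _; rewrite -EFinM lee_fin cabsR ger0_norm; last first.
    by rewrite invr_ge0 exprn_ge0// ler0n.
  rewrite /g -invfM lef_pV2 ?posrE ?mulr_gt0 ?exprn_gt0 ?ltr0n//.
  rewrite -!natrX -natrM ler_nat /maxnorm /=.
  have := leq_maxl `|u|%N `|v|%N; have := leq_maxr `|u|%N `|v|%N.
  move: (maxn _ _) => m; move: `|u|%N `|v|%N => a b bm am.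
  by rewrite (_ : 4 = 2 + 2)%N// expnD leq_mul// leq_sqr.
apply: le_lt_trans (esumZl_le sg0 _) _; first by move=> z; rewrite lee_fin.
by rewrite lte_mul_pinfty.
Qed.

Lemma abs_summable_bounded (I : choiceType) (a b : I -> C) (B : R) :
  abs_summable a -> (forall i, cabs (b i) <= B * cabs (a i)) -> abs_summable b.
Proof.
move=> sa ba; apply: le_abs_summable (abs_summableZ B%:C sa) => i.
rewrite cabsM cabsR (le_trans (ba i))//.
by apply: ler_wpM2r; [exact: cabs_ge0|exact: ler_norm].
Qed.

(** Multiplying T = sum_w c(w) F_w by F_w0 translates the coefficients to c(w - w0). As c is
    additive, F_w0 - 1 sends T to - c(w0) T1, where T1 = sum_w F_w. The two contributions cancel for
    a and add up to 2i T1 for its adjoint. *)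
Lemma exists_obstruction : exists (a : A) (T : G -> C) (B : R),
  [/\ supported H a, forall s, ~ H s -> T s = 0, forall s, cabs (T s) <= B,
      forall s, csum (fun t => a t * T (s - t)) = 0 &
      csum (fun t => star a t * T (0 - t)) != 0].
Proof.
pose rho (w : Z2) : C := ((maxnorm w).+1%:R ^- 4 : R)%:C.
have srho : abs_summable rho := abs_summable_maxnorm.
have crho w : cabs (rho w) = (maxnorm w).+1%:R ^- 4.
  by rewrite cabsR ger0_norm// invr_ge0 exprn_ge0// ler0n.
pose sg := fine (asum rho).
have sg0 : 0 <= sg by rewrite fine_ge0// asum_ge0.
pose n := (Num.truncn (2 * sg)).+1.
have nsg : 2 * sg < 2 ^+ n.
  rewrite (@lt_le_trans _ _ n%:R)//; last by rewrite -natrX ler_nat ltnW// ltn_expl.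
  by rewrite /n -truncn_lt_nat// mulr_ge0.
(* Four powers make [rho] summable. The n >= 1 others absorb a linear growth of the coefficients,
   and make the terms w != 0 of T1(0) sum to less than 1. *)
have [F [FD F1 FN FH Fle]] := exists_unitary_family R H0 HD HN infH (n + 4).
have Fsup w s : (maxnorm w).+1%:R * cabs (F w s) <= 2 * cabs (rho w).
  rewrite crho; have N0 : (0 : R) < (maxnorm w).+1%:R by rewrite ltr0n.
  rewrite -ler_pdivlMl// (le_trans (Fle w s))//.
  rewrite mulrCA ler_wpM2l// -invfM lef_pV2 ?posrE ?mulr_gt0 ?exprn_gt0//.
  by rewrite -exprS ler_weXn2l ?ler1n// /n; lia.
(* Coefficients of at most linear growth: this class contains [c] and [one] and is stable under
   translation. *)
pose lin (d : Z2 -> C) := exists2 B : R, 0 <= B &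
  forall w, cabs (d w) <= B * (maxnorm w).+1%:R.
have Fbd (d : Z2 -> C) (B : R) s w : 0 <= B ->
    (forall w, cabs (d w) <= B * (maxnorm w).+1%:R) ->
    cabs (d w * F w s) <= (B * 2) * cabs (rho w).
  move=> B0 dB; rewrite cabsM -mulrA.
  apply: le_trans (ler_wpM2l B0 (Fsup w s)); rewrite mulrA.
  by apply: ler_wpM2r; [exact: cabs_ge0|exact: dB].
have Fsum d s : lin d -> abs_summable (fun w => d w * F w s).
  by move=> [B B0 dB]; exact: (abs_summable_bounded srho (fun w => Fbd d B s w B0 dB)).
pose S (d : Z2 -> C) s := csum (fun w => d w * F w s).
have SD d d' s : lin d -> lin d' -> S (fun w => d w + d' w) s = S d s + S d' s.
  move=> ld ld'; rewrite /S -csumD; try exact: Fsum.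
  by congr csum; apply/funext => w; rewrite /= mulrDl.
have SZ z d s : lin d -> S (fun w => z * d w) s = z * S d s.
  move=> ld; rewrite /S -csumZ; last exact: Fsum.
  by congr csum; apply/funext => w; rewrite mulrA.
pose one (w : Z2) : C := 1.
have lin1 : lin one.
  by exists 1 => // w; rewrite /cabs Normc.normc1 mul1r ler1n.
pose c (w : Z2) : C := 'i%C * (w.1)%:~R + (w.2)%:~R.
have linc : lin c.
  exists 2 => // w; rewrite /c (le_trans (cabsD _ _))// cabsM cabsi mul1r.
  have cz (z : int) : cabs (z%:~R : C) = `|z|%N%:R.
    rewrite (_ : z%:~R = (z%:~R : R)%:C); last by rewrite rmorph_int.
    by rewrite cabsR -intr_norm -abszE -pmulrn.
  rewrite !cz -natrD -natrM ler_nat /maxnorm.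
  have := leq_maxl `|w.1|%N `|w.2|%N; have := leq_maxr `|w.1|%N `|w.2|%N.
  by lia.
have cD w w' : c (w + w') = c w + c w'.
  by rewrite /c /= !rmorphD mulrDr addrACA.
have lin_shift d w0 : lin d -> lin (fun w => d (w - w0)).
  move=> [B B0 dB]; exists (B * (maxnorm w0).+1%:R) => [|w].
    by rewrite mulr_ge0 ?ler0n.
  rewrite (le_trans (dB _))// -mulrA ler_wpM2l// -natrM ler_nat.
  by case: w w0 => [u v] [u0 v0]; rewrite /maxnorm /=; nia.
have SF d w0 s : lin d ->
    csum (fun t => F w0 t * S d (s - t)) = S (fun w => d (w - w0)) s.
  move=> ld.
  transitivity (csum (fun t => csum (fun w => d w * (F w0 t * F w (s - t))))).
    congr csum; apply/funext => t; rewrite /S -csumZ; last exact: Fsum.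
    by congr csum; apply/funext => w; rewrite mulrCA.
  rewrite csum_swap; last first.
    have [B B0 dB] := ld.
    rewrite /abs_summable asum_prod /=.
    apply: (@le_lt_trans _ _ (\esum_(t in [set: G])
      ((B * 2 * sg)%:E * (cabs (F w0 t))%:E))%E).
      apply: le_esum => t _.
      apply: (@le_trans _ _ (asum (fun w => (B * 2)%:C * F w0 t * rho w))).
        apply: le_asum => w; rewrite mulrCA [leLHS]cabsM.
        have -> : cabs ((B * 2)%:C * F w0 t * rho w) =
            cabs (F w0 t) * ((B * 2) * cabs (rho w)).
          rewrite !cabsM cabsR ger0_norm ?mulr_ge0//.
          by rewrite [RHS]mulrCA -!mulrA.
        by apply: ler_wpM2l; [exact: cabs_ge0|exact: Fbd].
      rewrite (le_trans (asumZ _ _))// cabsM cabsR ger0_norm ?mulr_ge0//.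
      rewrite -(fineK (asum_fin_num srho)) -/sg -!EFinM lee_fin.
      by rewrite mulrAC.
    apply: le_lt_trans (esumZl_le _ _) _.
    - by rewrite !mulr_ge0.
    - by move=> t; rewrite lee_fin cabs_ge0.
    - rewrite lte_mul_pinfty ?lee_fin ?mulr_ge0//; exact: l1gP.
  transitivity (csum (fun w => d w * F (w0 + w) s)).
    congr csum; apply/funext => w; rewrite csumZ; last exact: abs_summable_conv_at.
    by rewrite -l1gME -FD.
  rewrite /S -(@csum_reindex _ _ _ (fun w => w0 + w) (fun w => w - w0)
    (fun w => d (w - w0) * F w s)).
  - by congr csum; apply/funext => w /=; rewrite addrAC subrr add0r.
  - by move=> w; rewrite addrAC subrr add0r.
  - by move=> w; rewrite addrC subrK.
  - by apply: Fsum; exact: lin_shift.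
pose T := S c; pose T1 := S one.
have [B B0 TB] : exists2 B, 0 <= B & forall s, cabs (T s) <= B.
  have [B B0 cB] := linc; exists (B * 2 * sg); first by rewrite !mulr_ge0.
  move=> s; rewrite -lee_fin (le_trans (csum_leE (Fsum _ s linc)))//.
  apply: (@le_trans _ _ (asum (fun w => (B * 2)%:C * rho w))).
    apply: le_asum => w; rewrite [leRHS]cabsM cabsR ger0_norm ?mulr_ge0//; exact: (Fbd c).
  rewrite (le_trans (asumZ _ _))// cabsR ger0_norm ?mulr_ge0//.
  by rewrite -(fineK (asum_fin_num srho)) -/sg -EFinM.
pose act (a : A) s := csum (fun t => a t * T (s - t)).
have sact (a : A) s : abs_summable (fun t => a t * T (s - t)).
  apply: (@abs_summable_bounded _ _ _ B (l1gP a)) => t.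
  by rewrite cabsM mulrC ler_wpM2r ?cabs_ge0.
have actD a b s : act (a + b) s = act a s + act b s.
  rewrite /act -csumD//; congr csum; apply/funext => t; exact: mulrDl.
have actZ z a s : act (z *: a) s = z * act a s.
  by rewrite /act -csumZ//; congr csum; apply/funext => t; rewrite mulrA.
have actN a s : act (- a) s = - act a s by rewrite -scaleN1r actZ mulN1r.
have actF1 w0 s : act (F w0 - 1) s = - c w0 * T1 s.
  rewrite actD actN {1}/act SF//.
  have -> : act 1 s = T s.
    rewrite /act (@csum_single _ _ _ 0) ?l1g1E ?eqxx ?mul1r ?subr0// => t t0.
    by rewrite l1g1E (negbTE t0) mul0r.
  have -> : (fun w => c (w - w0)) = (fun w => c w + - c w0 * one w).
    apply/funext => w; rewrite /one mulr1; apply/eqP.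
    by rewrite eq_sym subr_eq -cD subrK.
  rewrite SD//; last first.
    exists (cabs (c w0)) => [|w]; first exact: cabs_ge0.
    rewrite /one mulr1 cabsN; apply: ler_peMr; first exact: cabs_ge0.
    by rewrite ler1n.
  by rewrite SZ// addrAC subrr add0r.
pose e1 : Z2 := (1, 0); pose e2 : Z2 := (0, 1).
have ce1 : c e1 = 'i%C by rewrite /c /= mulr1 addr0.
have ce2 : c e2 = 1 by rewrite /c /= mulr0 add0r.
have cN w : c (- w) = - c w.
  by apply: (@addrI _ (c w)); rewrite -cD !subrr /c /= mulr0 addr0.
pose a := F e1 - 1 - 'i%C *: (F e2 - 1).
have sa : star a = (F (- e1) - 1) + 'i%C *: (F (- e2) - 1).
  by rewrite /a !starB starZ conjci !starB !FN star1 scaleNr opprK.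
exists a, T, B; split => //.
- apply: supportedD.
    by apply: supportedD => //; rewrite -scaleN1r; apply/supportedZ/supported1.
  rewrite -scaleN1r; apply/supportedZ/supportedZ.
  by apply: supportedD => //; rewrite -scaleN1r; apply/supportedZ/supported1.
- by move=> s Hs; rewrite /T /S csum0// => w; rewrite FH ?mulr0.
- move=> s; rewrite -/(act a s) /a actD actN actZ !actF1 ce1 ce2.
  by rewrite !mulNr mul1r mulrN opprK addNr.
rewrite -/(act (star a) 0) sa actD actZ !actF1 !cN ce1 ce2 !opprK mul1r.
rewrite -mulr2n mulrn_eq0 /= mulf_eq0 negb_or; apply/andP; split.
  by apply/eqP => i0; have := @cabsi R; rewrite i0 cabs0 => /eqP; rewrite eq_sym oner_eq0.
(* The term w = 0 of T1(0) is 1. For w != 0 the base of the decay is at least 2, which saves the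
   factor 2^n. *)
pose r (w : Z2) : C := if w == 0 then 0 else F w 0.
have rbd w : cabs (r w) <= cabs ((2 / 2 ^+ n)%:C * rho w).
  rewrite /r; case: eqP => [_|/eqP w0]; first by rewrite cabs0 cabs_ge0.
  rewrite (le_trans (Fle _ _))// cabsM cabsR ger0_norm ?mulr_ge0// crho.
  rewrite -mulrA ler_wpM2l// addnC exprD invfM mulrC ler_wpM2r ?invr_ge0//.
  rewrite lef_pV2 ?posrE ?exprn_gt0// lerXn2r ?nnegrE// ler_nat ltnS lt0n.
  apply: contra w0; rewrite /maxnorm -leqn0 geq_max !leqn0 !absz_eq0 => /andP[u0 v0].
  by apply/eqP; case: w u0 v0 => u v /= /eqP -> /eqP ->.
have sr : abs_summable r.
  exact: (le_abs_summable rbd (abs_summableZ _ srho)).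
have rlt1 : cabs (csum r) < 1.
  apply: (@le_lt_trans _ _ ((2 / 2 ^+ n) * sg)); last first.
    by rewrite mulrAC ltr_pdivrMr ?exprn_gt0// mul1r.
  rewrite -lee_fin (le_trans (csum_leE sr))// (le_trans (le_asum rbd))//.
  rewrite (le_trans (asumZ _ _))// cabsR ger0_norm ?mulr_ge0//.
  by rewrite -(fineK (asum_fin_num srho)) -/sg -EFinM.
pose o (w : Z2) : C := if w == 0 then 1 else 0.
have oA w : w \notin [fset 0]%fset -> o w = 0 by rewrite inE /o => /negbTE ->.
have -> : T1 0 = 1 + csum r.
  transitivity (csum o + csum r).
    rewrite -csumD//; last exact: abs_summable_finsupp oA.
    congr csum; apply/funext => w; rewrite /= /o /r /one mul1r; case: eqP => [->|_].
      by rewrite F1 l1g1E eqxx addr0.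
    by rewrite add0r.
  by rewrite (@csum_single _ _ _ 0) /o ?eqxx// => w /negbTE ->.
apply/eqP => /(congr1 (fun z => z - csum r)); rewrite addrK sub0r => e.
by move: rlt1; rewrite -cabsN -e /cabs Normc.normc1 ltxx.
Qed.

End Obstruction.

(** * Induced ideals *)

Section InducedIdeals.
Variables (R : realType) (G : zmodType) (X : topologicalType).
Variables (cX : compact [set: X]) (sigma : top_action G X) (x : X).
Local Notation C := R[i].
Local Notation L1 := (l1 R G cX).
Implicit Types f g : L1.

Lemma actK s y : sigma (- s) (sigma s y) = y.
Proof. by rewrite -actD addNr act0. Qed.

Lemma stabilizer0 : stabilizer sigma x 0. Proof. exact: act0. Qed.

Lemma stabilizerD s t : stabilizer sigma x s -> stabilizer sigma x t ->
  stabilizer sigma x (s + t).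
Proof. by rewrite /stabilizer /= => sx tx; rewrite actD tx. Qed.

Lemma stabilizerN s : stabilizer sigma x s -> stabilizer sigma x (- s).
Proof. by rewrite /stabilizer /= => sx; rewrite -{1}sx actK. Qed.

Lemma asum_eval_le f (e : G -> G) (e' : G -> G) (y : G -> X) :
  cancel e e' -> cancel e' e -> (asum (fun t => f (e t) (y t)) <= l1norm f)%E.
Proof.
move=> ee' e'e; rewrite /l1norm (@reindex_esum R G G setT setT e); last first.
  by split=> // [s t _ _ /(can_inj ee')//|s _]; exists (e' s).
by apply: le_esum => t _; rewrite lee_fin cabs_le_supnorm.
Qed.

Lemma abs_summable_eval f (e : G -> G) (e' : G -> G) (y : G -> X) :
  cancel e e' -> cancel e' e -> abs_summable (fun t => f (e t) (y t)).
Proof. by move=> ee' e'e; exact: le_lt_trans (asum_eval_le f y ee' e'e) (l1P f). Qed.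

Lemma contfun_sumE (I : Type) (r : seq I) (h : I -> contfun R cX) y :
  (\sum_(i <- r) h i) y = \sum_(i <- r) h i y.
Proof. by elim/big_rec2 : _ => [//|i u v _ <-]; rewrite contfunDE. Qed.

Lemma supnorm_le_l1norm f t : supnorm (f t) <= fine (l1norm f).
Proof.
rewrite -lee_fin fineK ?l1norm_fin//.
exact: (@esum_ge_term R G (fun t => (supnorm (f t))%:E)).
Qed.

Lemma abs_summable_l1_mul f g s y :
  abs_summable (fun t => f t y * g (s - t) (sigma (- t) y)).
Proof.
have K : cancel (@id G) id by [].
apply: (@abs_summable_bounded _ _ _ _ (fine (l1norm g))
  (abs_summable_eval f (fun=> y) K K)) => t.
rewrite cabsM mulrC; apply: ler_wpM2r; first exact: cabs_ge0.
by rewrite (le_trans (cabs_le_supnorm _ _))// supnorm_le_l1norm.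
Qed.

(** Evaluation at y is a contraction on C(X), so it commutes with the limit that defines the
    product. *)
Lemma l1_mulE f g s y :
  l1_mul sigma f g s y = csum (fun t => f t y * g (s - t) (sigma (- t) y)).
Proof.
pose h t := contfun_mul (f t) (alpha sigma t (g (s - t))).
have hfin : (\esum_(t in [set: G]) (supnorm (h t))%:E < +oo)%E.
  pose M := fine (l1norm g).
  have gM t : supnorm (g t) <= M by exact: supnorm_le_l1norm.
  have M0 : 0 <= M := le_trans (supnorm_ge0 _) (gM 0).
  apply: (@le_lt_trans _ _ (\esum_(t in [set: G]) (M%:E * (supnorm (f t))%:E))%E).
    apply: le_esum => t _; rewrite -EFinM lee_fin (le_trans (supnorm_mul _ _))//.
    rewrite mulrC ler_wpM2r ?supnorm_ge0// (le_trans (supnorm_alpha _ _ _))//.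
  apply: le_lt_trans (esumZl_le M0 _) _.
    by move=> t; rewrite lee_fin supnorm_ge0.
  by rewrite lte_mul_pinfty ?lee_fin//; exact: l1P.
have hc := @is_cvg_sum R G _ h _ (fun t => contfun_normE (h t)) hfin.
apply/esym/csum_unique/(@cvgrPdist_lt _ _ _ totally) => e e0.
have /(@cvgrPdist_lt _ _ _ totally) /(_ _ e0) := hc.
apply: filterS => F HF.
apply: le_lt_trans HF.
rewrite contfun_normE normr_cabs lecR.
apply: (le_trans _ (cabs_le_supnorm _ y)).
rewrite contfunBE partial_sumE /partial_sum contfun_sumE.
by rewrite (big_seq_fsetE _ _ xpredT (fun t => h t y)).
Qed.

(** Each [e u] permutes G, so the inner sum over h is at most B |f(u)| times the norm of g, whatever
    the dependence on u. *)
Lemma abs_summable_double f g (B : R) (a : G * G -> C) (e e' : G -> G -> G) :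
  0 <= B -> (forall u, cancel (e u) (e' u)) -> (forall u, cancel (e' u) (e u)) ->
  (forall u h, cabs (a (u, h)) <= B * supnorm (f u) * supnorm (g (e u h))) ->
  abs_summable a.
Proof.
move=> B0 ee' e'e aB; rewrite /abs_summable asum_prod.
pose M := fine (l1norm g).
have M0 : 0 <= M by rewrite fine_ge0// l1norm_ge0.
apply: (@le_lt_trans _ _ (\esum_(u in [set: G]) ((B * M)%:E * (supnorm (f u))%:E))%E).
  apply: le_esum => u _.
  apply: (@le_trans _ _ (\esum_(h in [set: G])
      ((B * supnorm (f u))%:E * (supnorm (g (e u h)))%:E))%E).
    by apply: le_esum => h _; rewrite -EFinM lee_fin aB.
  apply: le_trans (esumZl_le _ _) _.
  - by rewrite mulr_ge0 ?supnorm_ge0.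
  - by move=> h; rewrite lee_fin supnorm_ge0.
  rewrite -(@reindex_esum R G G setT setT (e u) (fun s => (supnorm (g s))%:E)).
    rewrite -/(l1norm g) -(fineK (l1norm_fin g)) -/M -!EFinM lee_fin.
    by rewrite mulrAC.
  by split=> // [s t _ _ /(can_inj (ee' u))//|s _]; exists (e' u s) => //; rewrite e'e.
apply: le_lt_trans (esumZl_le _ _) _.
- by rewrite mulr_ge0.
- by move=> u; rewrite lee_fin supnorm_ge0.
by rewrite lte_mul_pinfty ?lee_fin ?mulr_ge0//; exact: l1P.
Qed.

Variables (psi : G -> C) (B : R).
Hypotheses (psiB : forall h, cabs (psi h) <= B).
Hypotheses (psiH : forall h, ~ stabilizer sigma x h -> psi h = 0).

Let B0 : 0 <= B. Proof. exact: le_trans (cabs_ge0 _) (psiB 0). Qed.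

(** The index s moves the base point along the orbit of x and t translates the group variable;
    letting both vary makes the common kernel stable under multiplication on either side. *)
Definition pairing f s t : C := csum (fun h => f (t + h) (sigma s x) * psi h).

Definition induced : set L1 := [set f | forall s t, pairing f s t = 0].

Let addKl (t : G) : cancel (fun h => t + h) (fun h => h - t).
Proof. by move=> h; rewrite addrAC subrr add0r. Qed.

Let subrKl (t : G) : cancel (fun h => h - t) (fun h => t + h).
Proof. by move=> h; rewrite addrC subrK. Qed.

Lemma asum_pairing f s t :
  (asum (fun h => f (t + h) (sigma s x) * psi h)%R <= B%:E * l1norm f)%E.
Proof.
apply: (@le_trans _ _ (asum (fun h => B%:C * f (t + h) (sigma s x))%R)).
  apply: le_asum => h; rewrite cabsM [leRHS]cabsM mulrC cabsR ger0_norm//.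
  by rewrite ler_wpM2r ?cabs_ge0.
rewrite (le_trans (asumZ _ _))// cabsR ger0_norm// lee_wpmul2l ?lee_fin//.
exact: (asum_eval_le f (fun=> sigma s x) (addKl t) (subrKl t)).
Qed.

Lemma abs_summable_pairing f s t :
  abs_summable (fun h => f (t + h) (sigma s x) * psi h).
Proof.
apply: (le_lt_trans (asum_pairing f s t)).
by rewrite lte_mul_pinfty ?lee_fin//; exact: l1P.
Qed.

Lemma l1_evalD f g t y : (f + g) t y = f t y + g t y. Proof. by []. Qed.

Lemma l1_evalZ z f t y : (z *: f) t y = z * f t y. Proof. by []. Qed.

Lemma pairingD f g s t : pairing (f + g) s t = pairing f s t + pairing g s t.
Proof.
rewrite /pairing -csumD; try exact: abs_summable_pairing.
by congr csum; apply/funext => h; rewrite l1_evalD mulrDl.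
Qed.

Lemma pairingZ z f s t : pairing (z *: f) s t = z * pairing f s t.
Proof.
rewrite /pairing -csumZ; last exact: abs_summable_pairing.
by congr csum; apply/funext => h; rewrite l1_evalZ mulrA.
Qed.

Lemma pairing_mull f g s t : pairing (l1_mul sigma f g) s t =
  csum (fun u => f u (sigma s x) * pairing g (s - u) (t - u)).
Proof.
have act_sub u : sigma (- u) (sigma s x) = sigma (s - u) x by rewrite -actD addrC.
pose a (u h : G) : C := f u (sigma s x) * (g (t - u + h) (sigma (s - u) x) * psi h).
transitivity (csum (fun h => csum (fun u => a u h))).
  congr csum; apply/funext => h; rewrite l1_mulE mulrC -csumZ.
    congr csum; apply/funext => u; rewrite act_sub /a [t - u + h]addrAC.
    by rewrite mulrC -mulrA.
  exact: abs_summable_l1_mul.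
rewrite csum_swap; last first.
  apply: (abs_summable_swap (a := fun p => a p.1 p.2)).
  apply: (@abs_summable_double f g B _ (fun u h => t - u + h) (fun u h => h - (t - u))) => //.
  move=> u h; rewrite /a /= !cabsM mulrA mulrC -mulrA; apply: ler_pM => //.
  - exact: cabs_ge0.
  - by rewrite mulr_ge0 ?cabs_ge0.
  - by apply: ler_pM; rewrite ?cabs_ge0 ?cabs_le_supnorm.
congr csum; apply/funext => u; rewrite /a csumZ//.
exact: abs_summable_pairing.
Qed.

(** After the substitution u = t + h - v, g v is evaluated at sigma(s - t + v - h) x. Since G is
    abelian and [psi] lives on the stabilizer, h drops out of this point, and the sum over h is a
    pairing of f. *)
Lemma pairing_mulr f g s t : pairing (l1_mul sigma f g) s t =
  csum (fun v => g v (sigma (s - t + v) x) * pairing f s (t - v)).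
Proof.
pose a (v h : G) : C := g v (sigma (s - t + v) x) * (f (t - v + h) (sigma s x) * psi h).
transitivity (csum (fun h => csum (fun v => a v h))).
  congr csum; apply/funext => h; rewrite l1_mulE.
  have [Hh|Hh] := pselect (stabilizer sigma x h); last first.
    by rewrite psiH// mulr0 csum0// => v; rewrite /a psiH// !mulr0.
  have K : cancel (fun v => t + h - v) (fun v => t + h - v) by move=> v; rewrite subKr.
  rewrite -(csum_reindex K K (abs_summable_l1_mul f g (t + h) (sigma s x))).
  have fgK := abs_summable_l1_mul f g (t + h) (sigma s x).
  rewrite mulrC -csumZ; last first.
    by rewrite /abs_summable (asum_reindex _ K K).
  congr csum; apply/funext => v; rewrite /= subKr -actD.
  have -> : sigma (- (t + h - v) + s) x = sigma (s - t + v) x.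
    have -> : - (t + h - v) + s = (s - t + v) + - h.
      by rewrite !opprD opprK addrC !addrA [RHS]addrAC.
    by rewrite actD (stabilizerN Hh).
  by rewrite /a [t - v + h]addrAC mulrC -mulrA mulrCA.
rewrite csum_swap; last first.
  apply: (abs_summable_swap (a := fun p => a p.1 p.2)).
  apply: (@abs_summable_double g f B _ (fun u h => t - u + h) (fun u h => h - (t - u))) => //.
  move=> u h; rewrite /a /= !cabsM mulrA mulrC -mulrA; apply: ler_pM => //.
  - exact: cabs_ge0.
  - by rewrite mulr_ge0 ?cabs_ge0.
  - by apply: ler_pM; rewrite ?cabs_ge0 ?cabs_le_supnorm.
congr csum; apply/funext => u; rewrite /a csumZ//.
exact: abs_summable_pairing.
Qed.

Lemma induced_ideal : is_ideal sigma induced.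
Proof.
split.
- by move=> s t; rewrite /pairing csum0// => h; exact: mul0r.
- by move=> f g If Ig s t; rewrite pairingD If Ig addr0.
- by move=> z f If s t; rewrite pairingZ If mulr0.
- by move=> f g Ig s t; rewrite pairing_mull csum0// => u; rewrite Ig mulr0.
- by move=> f g If s t; rewrite pairing_mulr csum0// => u; rewrite If mulr0.
Qed.

(** An intersection of kernels of functionals of norm at most B. *)
Lemma induced_closed : closed induced.
Proof.
move=> f cf s t; apply: cabs_eq0; apply/eqP; rewrite eq_le cabs_ge0 andbT.
apply/ler_addgt0Pr => e e0; rewrite add0r.
(* B may be 0. *)
pose d := e / (B + 1).
have d0 : 0 < d by rewrite divr_gt0// ltr_wpDl.
have d0' : (0 : C) < d%:C by rewrite ltcR.
have [g [Ig]] := cf _ (nbhsx_ballx f _ d0').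
rewrite -ball_normE /ball_ /= l1_normE ltcR => fg.
have -> : pairing f s t = pairing (f - g) s t.
  by rewrite pairingD -scaleN1r pairingZ Ig mulr0 addr0.
rewrite -lee_fin (le_trans (csum_leE (abs_summable_pairing _ _ _)))//.
rewrite (le_trans (asum_pairing _ _ _))//.
rewrite -(fineK (l1norm_fin (f - g))) -EFinM lee_fin.
apply: (@le_trans _ _ ((B + 1) * d)); last by rewrite mulrC divfK// gt_eqF// ltr_wpDl.
apply: ler_pM => //; last exact: ltW.
  by rewrite fine_ge0// l1norm_ge0.
by rewrite lerDl.
Qed.

End InducedIdeals.

(** * Constant functions on X and the conclusion *)

Section ConstantLift.
Variables (R : realType) (G : zmodType) (X : topologicalType).
Variables (cX : compact [set: X]).
Local Notation C := R[i].

Fact contfun_cst_subproof (z : C) : (fun _ : X => z) \in @continuous_pred R X.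
Proof. by apply/continuous_predP => y; exact: cvg_cst. Qed.

Definition contfun_cst z : contfun R cX := ContFun cX (contfun_cst_subproof z).

Fact lift_subproof (a : l1g R G) : (fun t => contfun_cst (a t)) \in @l1_pred R G X cX.
Proof.
rewrite unfold_in; apply: le_lt_trans (l1gP a).
by apply: le_esum => t _; rewrite lee_fin supnorm_le ?cabs_ge0.
Qed.

(** The action fixes constant functions, so this embedding respects the involutions of both
    algebras. *)
Definition lift a : l1 R G cX := L1 (lift_subproof a).

End ConstantLift.

Theorem lemma4p5 (R : realType) (G : zmodType) (X : topologicalType)
    (cX : compact [set: X]) (hX : hausdorff_space X) (sigma : top_action G X)
    (countG : countable [set: G]) (infG : infinite_set [set: G])
    (infGx : exists x : X, infinite_set (stabilizer sigma x)) :
  exists I : set (l1 R G cX),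
    [/\ is_ideal sigma I, closed I & ~ self_adjoint sigma I].
Proof.
have [x infx] := infGx.
have [a [T [B [Ha TH TB aT saT]]]] := @exists_obstruction R G _
  (stabilizer0 sigma x) (@stabilizerD _ _ sigma x) (@stabilizerN _ _ sigma x) infx.
(* With this sign the pairing of [lift cX a] at (s, t) is the convolution a * T at t. *)
pose psi h := T (- h).
have psiB h : cabs (psi h) <= B by exact: TB.
have psiH h : ~ stabilizer sigma x h -> psi h = 0.
  by move=> Hh; apply: TH => /stabilizerN; rewrite opprK.
exists (induced sigma x psi); split.
- exact: induced_ideal psiB psiH.
- exact: induced_closed psiB.
move=> sI; have Ia : induced sigma x psi (lift cX a).
  move=> s t; rewrite -[RHS](aT t) /pairing.
  rewrite -(@csum_reindex _ _ _ (fun h => t + h) (fun h => h - t)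
    (fun k => a k * T (t - k))).
  - by congr csum; apply/funext => h /=; rewrite /psi opprD addrA subrr add0r.
  - by move=> h; rewrite addrAC subrr add0r.
  - by move=> h; rewrite addrC subrK.
  - apply: (@abs_summable_bounded _ _ _ _ B (l1gP a)) => k.
    by rewrite cabsM mulrC ler_wpM2r ?cabs_ge0.
(* At s = t = 0 the pairing of the adjoint is the sum that [exists_obstruction] makes nonzero. *)
move: saT; have := sI _ Ia 0 0; rewrite /pairing => e /eqP[]; rewrite -[RHS]e.
by congr csum; apply/funext => h; rewrite /psi sub0r add0r.
Qed.
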